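(* Let $m,p,n\geq1$ and let $\mathcal{X}_1,\dots,\mathcal{X}_n\in\mathbb{C}^{m\times m\times p}$ be independent random Hermitian T-product tensors such that almost surely $\mathcal{X}_i\succeq\mathcal{O}$ and $\lambda_{\max}(\mathcal{X}_i)\leq 1$ for each $i$. Define $$\overline{\mu}_{\max}=\lambda_{\max}\left(\frac1n\sum_{i=1}^n\mathbb{E}\mathcal{X}_i\right),\qquad \overline{\mu}_{\min}=\lambda_{\min}\left(\frac1n\sum_{i=1}^n\mathbb{E}\mathcal{X}_i\right).$$ Then $$\Pr\left(\lambda_{\max}\left(\frac1n\sum_{i=1}^n\mathcal{X}_i\right)\geq\theta\right)\leq mp\,e^{-n\,\mathfrak{D}(\theta\,\Vert\,\overline{\mu}_{\max})}\quad\text{for }\overline{\mu}_{\max}\leq\theta\leq1,$$ and $$\Pr\left(\lambda_{\min}\left(\frac1n\sum_{i=1}^n\mathcal{X}_i\right)\leq\theta\right)\leq mp\,e^{-n\,\mathfrak{D}(\theta\,\Vert\,\overline{\mu}_{\min})}\quad\text{for }0\leq\theta\leq\overline{\mu}_{\min}.$$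
   Context: For $\mathcal{A}\in\mathbb{C}^{m\times n\times p}$ with frontal slices $A^{(1)},\dots,A^{(p)}$, $\mathrm{bcirc}(\mathcal{A})\in\mathbb{C}^{mp\times np}$ is the block circulant matrix whose $(r,s)$ block is $A^{(((r-s)\bmod p)+1)}$. The conjugate transpose $\mathcal{A}^{\mathrm H}$ is obtained by conjugate-transposing every frontal slice and reversing the order of slices $2,\dots,p$, so $\mathrm{bcirc}(\mathcal{A}^{\mathrm H})=\mathrm{bcirc}(\mathcal{A})^{\mathrm H}$. $\mathcal{A}\in\mathbb{C}^{m\times m\times p}$ is Hermitian if $\mathcal{A}^{\mathrm H}=\mathcal{A}$; its eigenvalues are the $mp$ eigenvalues of $\mathrm{bcirc}(\mathcal{A})$, with largest/smallest $\lambda_{\max}$/$\lambda_{\min}$. For Hermitian $\mathcal{A},\mathcal{B}$, $\mathcal{A}\preceq\mathcal{B}$ means $\mathrm{bcirc}(\mathcal{B}-\mathcal{A})$ is positive semidefinite; $\mathcal{O}$ is the zero tensor. Expectation of a random tensor is taken entrywise. For $c,d\in[0,1]$ the binary information divergence is $\mathfrak{D}(c\Vert d)=c\log\frac{c}{d}+(1-c)\log\frac{1-c}{1-d}$ (with the usual conventions $0\log 0=0$). *)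

(* Defs.v *)
From HB Require Import structures.
From mathcomp Require Import all_boot all_order all_algebra.
From mathcomp Require Import all_classical all_reals all_analysis.
From mathcomp Require Import complex mxtens.

Set Implicit Arguments.
Unset Strict Implicit.
Unset Printing Implicit Defensive.

Import Order.TTheory GRing.Theory Num.Theory.
Local Open Scope classical_set_scope.
Local Open Scope ring_scope.

Section TProduct.
Variable R : realType.

(* A third-order tensor in C^{m x n x p}: its p frontal slices, slice k+1 at index k. *)
Definition tensor (m n p : nat) := {ffun 'I_p -> 'M[R[i]]_(m, n)}.

Lemma circ_idx_proof p (r s : 'I_p) : ((r + p - s) %% p < p)%N.
Proof. by apply: ltn_pmod; apply: leq_ltn_trans (ltn_ord r). Qed.

Definition circ_idx p (r s : 'I_p) : 'I_p := Ordinal (circ_idx_proof r s).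

Lemma rev_idx_proof p (k : 'I_p) : ((p - k) %% p < p)%N.
Proof. by apply: ltn_pmod; apply: leq_ltn_trans (ltn_ord k). Qed.

(* 0-based index (-k mod p): keeps slice 1 and reverses slices 2..p *)
Definition rev_idx p (k : 'I_p) : 'I_p := Ordinal (rev_idx_proof k).

Definition ctrmx m n (M : 'M[R[i]]_(m, n)) : 'M[R[i]]_(n, m) :=
  (map_mx (@conjc R) M)^T.

(* block circulant matrix: block (r,s) (0-based) is slice ((r - s) mod p);
   row index of 'I_(p*m) is decoded as (block r, inner a). *)
Definition bcirc m n p (A : tensor m n p) : 'M[R[i]]_(p * m, p * n) :=
  \matrix_(i, j) A (circ_idx (mxtens_unindex i).1 (mxtens_unindex j).1)
                   (mxtens_unindex i).2 (mxtens_unindex j).2.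

Definition tctr m n p (A : tensor m n p) : tensor n m p :=
  [ffun k => ctrmx (A (rev_idx k))].

Definition thermitian m p (A : tensor m m p) : Prop := tctr A = A.

Definition psdmx N (M : 'M[R[i]]_N) : Prop :=
  forall v : 'cV[R[i]]_N, 0 <= (ctrmx v *m M *m v) 0 0.

Definition tle m p (A B : tensor m m p) : Prop := psdmx (bcirc (B - A)).

(* the eigenvalues of a tensor are the eigenvalues of bcirc; for Hermitian
   tensors they are real, and lambda_max / lambda_min are the largest /
   smallest of them. *)
Definition teig m p (A : tensor m m p) : set R :=
  [set x : R | eigenvalue (bcirc A) (x%:C)%C].

Definition lambda_max m p (A : tensor m m p) : R := sup (teig A).
Definition lambda_min m p (A : tensor m m p) : R := inf (teig A).

Definition xlogxy (c d : R) : \bar R :=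
  if c == 0 then 0%E else if d == 0 then +oo%E else (c * ln (c / d))%:E.

Definition bdiv (c d : R) : \bar R := (xlogxy c d + xlogxy (1 - c) (1 - d))%E.

End TProduct.

Section Random.
Context (d : measure_display) (T : measurableType d) (R : realType).

(* coordinate sigma-algebra on tensors (= Borel sets of R^{2mnp}) *)
Definition tensor_gen m n p : set (set (tensor R m n p)) :=
  [set A | exists k a b, exists2 B : set R, measurable B &
     A = (fun t : tensor R m n p => complex.Re (t k a b)) @^-1` B \/
     A = (fun t : tensor R m n p => complex.Im (t k a b)) @^-1` B].

Definition tensor_measurable m n p (A : set (tensor R m n p)) : Prop :=
  <<s (@tensor_gen m n p) >> A.

Definition random_tensor m n p (X : T -> tensor R m n p) : Prop :=
  forall k a b, measurable_fun setT (fun w => complex.Re (X w k a b)) /\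
                measurable_fun setT (fun w => complex.Im (X w k a b)).

Definition independent_tensors (P : probability T R) N m n p
    (X : 'I_N -> T -> tensor R m n p) : Prop :=
  forall B : 'I_N -> set (tensor R m n p),
    (forall i, tensor_measurable (B i)) ->
    P (\bigcap_(i in [set: 'I_N]) (X i @^-1` B i)) =
    (\prod_(i < N) P (X i @^-1` B i))%E.

Definition texpect (P : probability T R) m n p (X : T -> tensor R m n p)
  : tensor R m n p :=
  [ffun k => \matrix_(a, b)
     (fine 'E_P[fun w => complex.Re (X w k a b)] +i* fine 'E_P[fun w => complex.Im (X w k a b)])%C].

End Random.

(* Main.v *)
Require Import Defs.
From HB Require Import structures.
From mathcomp Require Import all_boot all_order all_algebra.
From mathcomp Require Import all_classical all_reals all_analysis.
From mathcomp Require Import complex mxtens.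
From mathcomp Require Import measurable_realfun ring lra.

Import Order.TTheory GRing.Theory Num.Theory.
Import numFieldNormedType.Exports.
Local Open Scope classical_set_scope.
Local Open Scope ring_scope.

Set Implicit Arguments.
Unset Strict Implicit.
Unset Printing Implicit Defensive.

(** The eigenvalues of a T-product tensor are those of its block circulant
    matrix, so this is the matrix Chernoff bound in dimension [m * p].  By Markov's
    inequality for [Tr exp] it is enough to bound [E Tr exp (t (X_1 + ... + X_n))]
    by [m p (1 + (e^t - 1) mu)^n] and to optimise over [t].

    The summands are integrated out one at a time with
      [E Tr exp (H + t X) <= Tr exp (H + log (1 + (e^t - 1) E X))],
    an instance of Lieb's theorem.  Put [T = exp (H + t X)] and
    [A = 1 + (e^t - 1) X].  Since [t X <= log A], the relative entropy
    [D(T|A) = Tr T (log T - log A)] is at most [Tr T H]; its joint convexity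
    carries this inequality to [E T] and [E A], and Klein's inequality then bounds
    [Tr E T].  Joint convexity holds because [- log x] is a limit of Riemann sums
    of [l |-> (1 - x) / ((1 - l) x + l)], each term of which gives a
    quadratic-over-linear function of [(T, A)], that is, a supremum of linear ones.

    Finally [log m <= log l + m / l - 1] bounds the largest eigenvalue of the sum
    of the [log (1 + (e^t - 1) E X_i)] by [n log l], where [l] is
    [1 + (e^t - 1) mu]. *)

(** * Hermitian matrices *)

Section ComplexParts.
Variable R : realType.
Local Notation C := R[i].
Local Notation re := (@complex.Re R).
Local Notation im := (@complex.Im R).

(** Matrices are compared through the squared overlaps of their eigenbases. These weights are doubly
    stochastic and turn each trace inequality into a scalar inequality between pairs of eigenvalues,
    so that operator monotonicity and operator convexity never enter. Spectral decompositions come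
    from a choice that need not be measurable in the random parameter. The sign of [t] stays free up
    to the tail bounds, so one moment bound serves both tails: [t >= 0] for the largest eigenvalue,
    [t <= 0] for the smallest. *)

Definition sqnorm (z : C) : R := re z ^+ 2 + im z ^+ 2.

Lemma sqnorm_ge0 z : 0 <= sqnorm z. Proof. by rewrite addr_ge0 ?sqr_ge0. Qed.

Lemma reD (x y : C) : re (x + y) = re x + re y. Proof. by case: x y => ? ? []. Qed.
Lemma imD (x y : C) : im (x + y) = im x + im y. Proof. by case: x y => ? ? []. Qed.
Lemma reN (x : C) : re (- x) = - re x. Proof. by case: x. Qed.
Lemma reM (x y : C) : re (x * y) = re x * re y - im x * im y.
Proof. by case: x y => ? ? []. Qed.
Lemma imM (x y : C) : im (x * y) = re x * im y + im x * re y.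
Proof. by case: x y => ? ? []. Qed.
Lemma reZ (a : R) (x : C) : re (a%:C%C * x) = a * re x.
Proof. by rewrite reM /= mul0r subr0. Qed.
Lemma imZ (a : R) (x : C) : im (a%:C%C * x) = a * im x.
Proof. by rewrite imM /= mul0r addr0. Qed.
Lemma re_sum (I : Type) (r : seq I) (P : pred I) (F : I -> C) :
  re (\sum_(i <- r | P i) F i) = \sum_(i <- r | P i) re (F i).
Proof. by rewrite (big_morph _ reD (erefl : re 0 = 0)). Qed.
Lemma im_sum (I : Type) (r : seq I) (P : pred I) (F : I -> C) :
  im (\sum_(i <- r | P i) F i) = \sum_(i <- r | P i) im (F i).
Proof. by rewrite (big_morph _ imD (erefl : im 0 = 0)). Qed.

Lemma conjM_sqnorm (z : C) : z^*%C * z = (sqnorm z)%:C%C.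
Proof.
by case: z => a b; apply/eqP; rewrite eq_complex /sqnorm /=; apply/andP; split; apply/eqP; ring.
Qed.

Lemma sqnorm_conj (z : C) : sqnorm (z^*)%C = sqnorm z.
Proof. by case: z => a b; rewrite /sqnorm /= sqrrN. Qed.

Lemma ctrmxM m n p (A : 'M[C]_(m, n)) (B : 'M[C]_(n, p)) :
  ctrmx (A *m B) = ctrmx B *m ctrmx A.
Proof. by rewrite /ctrmx map_mxM trmx_mul. Qed.
Lemma ctrmxK m n (A : 'M[C]_(m, n)) : ctrmx (ctrmx A) = A.
Proof. by apply/matrixP=> i j; rewrite !mxE conjcK. Qed.
Lemma ctrmxD m n (A B : 'M[C]_(m, n)) : ctrmx (A + B) = ctrmx A + ctrmx B.
Proof. by rewrite /ctrmx map_mxD linearD. Qed.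
Lemma ctrmxZ m n (a : R) (A : 'M[C]_(m, n)) : ctrmx (a%:C%C *: A) = a%:C%C *: ctrmx A.
Proof. by rewrite /ctrmx map_mxZ linearZ /= oppr0. Qed.
Lemma ctrmx0 m n : ctrmx (0 : 'M[C]_(m, n)) = 0.
Proof. by rewrite /ctrmx map_mx0 trmx0. Qed.
Lemma ctrmx1 n : ctrmx (1%:M : 'M[C]_n) = 1%:M.
Proof. by rewrite /ctrmx map_mx1 trmx1. Qed.
Lemma ctrmx_sum m n (I : Type) (r : seq I) (F : I -> 'M[C]_(m, n)) :
  ctrmx (\sum_(i <- r) F i) = \sum_(i <- r) ctrmx (F i).
Proof. exact: (big_morph _ (@ctrmxD m n) (ctrmx0 m n)). Qed.

Definition rtr N (M : 'M[C]_N) : R := re (\tr M).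

Lemma rtrD N (A B : 'M[C]_N) : rtr (A + B) = rtr A + rtr B.
Proof. by rewrite /rtr mxtraceD reD. Qed.
Lemma rtrZ N (a : R) (A : 'M[C]_N) : rtr (a%:C%C *: A) = a * rtr A.
Proof. by rewrite /rtr mxtraceZ reZ. Qed.
Lemma rtr_sum N (I : Type) (r : seq I) (F : I -> 'M[C]_N) :
  rtr (\sum_(i <- r) F i) = \sum_(i <- r) rtr (F i).
Proof.
apply: (big_morph _ (@rtrD N)); by rewrite /rtr mxtrace0.
Qed.

Definition unimx N (U : 'M[C]_N) := ctrmx U *m U = 1%:M.

Lemma unimxr N (U : 'M[C]_N) : unimx U -> U *m ctrmx U = 1%:M.
Proof. exact: mulmx1C. Qed.

Definition rdiag N (a : 'I_N -> R) : 'M[C]_N := diag_mx (\row_i (a i)%:C%C).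

Definition unidiag N (U : 'M[C]_N) (a : 'I_N -> R) := U *m rdiag a *m ctrmx U.

Lemma ctrmx_rdiag N (a : 'I_N -> R) : ctrmx (rdiag a) = rdiag a.
Proof.
apply/matrixP=> i j; rewrite !mxE eq_sym.
by case: eqVneq => [->|_]; rewrite ?mulr1n ?mulr0n /= ?oppr0.
Qed.

Lemma ctrmx_unidiag N (U : 'M[C]_N) (a : 'I_N -> R) : ctrmx (unidiag U a) = unidiag U a.
Proof. by rewrite /unidiag !ctrmxM ctrmxK ctrmx_rdiag mulmxA. Qed.

(** [spectralmx] diagonalises every normal matrix over the complex numbers; Hermitian symmetry makes
    the spectral diagonal real, so the real parts taken here lose nothing. *)
Lemma spectral_herm N (H : 'M[C]_N) : ctrmx H = H ->
  unimx (ctrmx (spectralmx H)) /\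
  H = unidiag (ctrmx (spectralmx H)) (fun i => re (spectral_diag H 0 i)).
Proof.
move=> hH.
have tC (M : 'M[C]_N) : map_mx Num.conj M^T = ctrmx M by rewrite /ctrmx map_trmx.
have hs : H \is hermsymmx.
  by apply/is_hermitianmxP; rewrite expr0 scale1r tC hH.
have hu := spectral_unitarymx H.
have u1 : spectralmx H *m ctrmx (spectralmx H) = 1%:M.
  by move/unitarymxP: hu; rewrite tC.
split; first by rewrite /unimx ctrmxK.
have /orthomx_spectralP e := hermitian_normalmx hs.
rewrite [LHS]e /unidiag ctrmxK (invmx_unitary hu) tC; congr (_ *m _ *m _).
congr diag_mx; apply/rowP=> i; rewrite mxE.
have /mxOverP/(_ 0 i) := hermitian_spectral_diag_real hs.
by move/RRe_real.
Qed.

(* Meaningful for Hermitian matrices only. *)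
Definition eigbasis N (H : 'M[C]_N) : 'M[C]_N := ctrmx (spectralmx H).
Definition eigval N (H : 'M[C]_N) (i : 'I_N) : R := re (spectral_diag H 0 i).
Definition hermfun (f : R -> R) N (H : 'M[C]_N) : 'M[C]_N := unidiag (eigbasis H) (f \o eigval H).

Lemma eigbasis_uni N (H : 'M[C]_N) : ctrmx H = H -> unimx (eigbasis H).
Proof. by case/spectral_herm. Qed.
Lemma spectral_decomp N (H : 'M[C]_N) : ctrmx H = H -> unidiag (eigbasis H) (eigval H) = H.
Proof. by case/spectral_herm=> _ <-. Qed.
Lemma hermfun_herm f N (H : 'M[C]_N) : ctrmx (hermfun f H) = hermfun f H.
Proof. exact: ctrmx_unidiag. Qed.

Lemma rdiagE N (a : 'I_N -> R) i j : rdiag a i j = (a i)%:C%C *+ (i == j).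
Proof. by rewrite !mxE. Qed.

Lemma mul_rdiag N M (a : 'I_N -> R) (B : 'M[C]_(N, M)) i j :
  (rdiag a *m B) i j = (a i)%:C%C * B i j.
Proof. by rewrite mul_diag_mx !mxE. Qed.
Lemma mul_mxrdiag N M (a : 'I_N -> R) (B : 'M[C]_(M, N)) i j :
  (B *m rdiag a) i j = B i j * (a j)%:C%C.
Proof. by rewrite mul_mx_diag !mxE. Qed.

Lemma rdiag1 N : rdiag (fun=> 1) = 1%:M :> 'M[C]_N.
Proof. by apply/matrixP=> i j; rewrite rdiagE !mxE. Qed.

Lemma rtr_rdiag2 N (a t : 'I_N -> R) (W : 'M[C]_N) :
  rtr (rdiag a *m W *m rdiag t *m ctrmx W) = \sum_i \sum_j a i * t j * sqnorm (W i j).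
Proof.
rewrite /rtr /mxtrace re_sum; apply: eq_bigr => i _.
rewrite mxE re_sum; apply: eq_bigr => j _.
rewrite mul_mxrdiag mul_rdiag !mxE.
rewrite (_ : _ * _ = (a i * t j)%:C%C * ((W i j)^*%C * W i j)); last first.
  by rewrite rmorphM /=; ring.
by rewrite conjM_sqnorm reZ.
Qed.

(** For unitary [U] and [V] this is a doubly stochastic matrix. It rewrites the trace of a product
    of two diagonalised matrices as a double sum over pairs of eigenvalues. *)
Definition overlap N (U V : 'M[C]_N) i j : R := sqnorm ((ctrmx U *m V) i j).

Lemma overlap_ge0 N (U V : 'M[C]_N) i j : 0 <= overlap U V i j.
Proof. exact: sqnorm_ge0. Qed.

Lemma unidiagM N (U : 'M[C]_N) a b : unimx U ->
  unidiag U a *m unidiag U b = unidiag U (fun i => a i * b i).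
Proof.
move=> hU; rewrite /unidiag -!mulmxA (mulmxA (ctrmx U)) hU mul1mx; congr (_ *m _).
rewrite !mulmxA; congr (_ *m _); apply/matrixP=> i j.
by rewrite mul_rdiag !rdiagE rmorphM /= mulrnAr.
Qed.

Lemma rtr_unidiag2 N (U V : 'M[C]_N) a t :
  rtr (unidiag U a *m unidiag V t) = \sum_i \sum_j a i * t j * overlap U V i j.
Proof.
rewrite -rtr_rdiag2 /rtr /unidiag ctrmxM ctrmxK -!mulmxA mxtrace_mulC.
by rewrite -!mulmxA.
Qed.

Lemma unidiag1 N (U : 'M[C]_N) : unimx U -> unidiag U (fun=> 1) = 1%:M.
Proof. by move=> h; rewrite /unidiag rdiag1 mulmx1 unimxr. Qed.

Lemma rtr_unidiag N (U : 'M[C]_N) a : unimx U -> rtr (unidiag U a) = \sum_i a i.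
Proof.
move=> h; rewrite /rtr /unidiag mxtrace_mulC mulmxA h mul1mx /mxtrace re_sum.
by apply: eq_bigr => i _; rewrite rdiagE eqxx.
Qed.

(** The trace of the projector onto column [j] of [V], computed in two ways. *)
Lemma overlap_suml N (U V : 'M[C]_N) j : unimx U -> unimx V -> \sum_i overlap U V i j = 1.
Proof.
move=> hU hV; pose t k : R := (k == j)%:R.
have := rtr_unidiag2 U V (fun=> 1) t; rewrite unidiag1 // mul1mx rtr_unidiag //.
have tE k : k != j -> t k = 0 by rewrite /t => /negbTE ->.
have tj : t j = 1 by rewrite /t eqxx.
rewrite (bigD1 j) //= tj big1 ?addr0 // => ->; apply: eq_bigr => i _.
rewrite (bigD1 j) //= tj !mul1r big1 ?addr0 // => k kj.
by rewrite tE // mulr0 mul0r.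
Qed.

Lemma overlap_sumr N (U V : 'M[C]_N) i : unimx U -> unimx V -> \sum_j overlap U V i j = 1.
Proof.
move=> hU hV; rewrite -(overlap_suml i hV hU); apply: eq_bigr => j _.
rewrite /overlap -sqnorm_conj -[in RHS](ctrmxK U) -ctrmxM; congr sqnorm.
by rewrite [RHS]mxE [RHS]mxE.
Qed.

Lemma rtr_unidiag_overlap_r N (U V : 'M[C]_N) t : unimx U -> unimx V ->
  rtr (unidiag V t) = \sum_i \sum_j t j * overlap U V i j.
Proof.
move=> hU hV; rewrite rtr_unidiag // exchange_big /=; apply: eq_bigr => j _.
by rewrite -mulr_sumr overlap_suml // mulr1.
Qed.

Lemma rtr_unidiag_overlap_l N (U V : 'M[C]_N) a : unimx U -> unimx V ->
  rtr (unidiag U a) = \sum_i \sum_j a i * overlap U V i j.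
Proof.
move=> hU hV; rewrite rtr_unidiag //; apply: eq_bigr => i _.
by rewrite -mulr_sumr overlap_sumr // mulr1.
Qed.

(** The semidefinite order is handled through this form because it is linear in [M] and so commutes
    with expectation. Bounds are written against [qf 1%:M v], the squared norm of [v], which avoids
    normalising [v]. *)
Definition qf N (M : 'M[C]_N) (v : 'cV[C]_N) : R := re ((ctrmx v *m M *m v) 0 0).

Lemma qf_rtr N (M : 'M[C]_N) v : qf M v = rtr (v *m ctrmx v *m M).
Proof.
by rewrite /rtr -mulmxA mxtrace_mulC /mxtrace big_ord1.
Qed.

Lemma qfD N (A B : 'M[C]_N) v : qf (A + B) v = qf A v + qf B v.
Proof. by rewrite !qf_rtr mulmxDr rtrD. Qed.
Lemma qfZ N (a : R) (A : 'M[C]_N) v : qf (a%:C%C *: A) v = a * qf A v.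
Proof. by rewrite !qf_rtr -scalemxAr rtrZ. Qed.
Lemma qf_sum N (I : Type) (r : seq I) (F : I -> 'M[C]_N) v :
  qf (\sum_(i <- r) F i) v = \sum_(i <- r) qf (F i) v.
Proof. by rewrite qf_rtr mulmx_sumr rtr_sum; apply: eq_bigr => i _; rewrite qf_rtr. Qed.

Lemma qf_unidiag N (U : 'M[C]_N) a v :
  qf (unidiag U a) v = \sum_i a i * sqnorm ((ctrmx U *m v) i 0).
Proof.
rewrite /qf /unidiag (_ : _ *m _ *m _ =
    ctrmx (ctrmx U *m v) *m (rdiag a *m (ctrmx U *m v))); last first.
  by rewrite ctrmxM ctrmxK !mulmxA.
set w := ctrmx U *m v; rewrite mxE re_sum; apply: eq_bigr => i _.
have -> : ctrmx w 0 i = (w i 0)^*%C by rewrite mxE mxE.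
by rewrite mul_rdiag mulrCA conjM_sqnorm reZ.
Qed.

Lemma qf1_unidiag N (U : 'M[C]_N) v : unimx U -> qf 1%:M v = \sum_i sqnorm ((ctrmx U *m v) i 0).
Proof. by move=> h; rewrite -(unidiag1 h) qf_unidiag; apply: eq_bigr => i _; rewrite mul1r. Qed.

Lemma qf1_ge0 N (v : 'cV[C]_N) : 0 <= qf 1%:M v.
Proof.
rewrite (@qf1_unidiag _ 1%:M); first by apply: sumr_ge0 => i _; exact: sqnorm_ge0.
by rewrite /unimx ctrmx1 mulmx1.
Qed.

Lemma uni_col N (U : 'M[C]_N) i j : unimx U ->
  (ctrmx U *m col j U) i 0 = (i == j)%:R.
Proof. by move=> h; rewrite colE mulmxA h mul1mx mxE eqxx andbT. Qed.

Lemma sqnorm_nat (b : bool) : sqnorm (b%:R : C) = b%:R.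
Proof. by case: b; rewrite /sqnorm /= ?expr0n ?expr1n ?addr0. Qed.

Lemma qf_unidiag_col N (U : 'M[C]_N) a j : unimx U -> qf (unidiag U a) (col j U) = a j.
Proof.
move=> h; rewrite qf_unidiag (bigD1 j) //= uni_col // eqxx sqnorm_nat mulr1 big1 ?addr0 //.
by move=> i /negbTE ij; rewrite uni_col // ij sqnorm_nat mulr0.
Qed.

Lemma qf1_col N (U : 'M[C]_N) j : unimx U -> qf 1%:M (col j U) = 1.
Proof. by move=> h; rewrite -(unidiag1 h) qf_unidiag_col. Qed.

Lemma qf_le_unidiag N (U : 'M[C]_N) a x v : unimx U -> (forall i, a i <= x) ->
  qf (unidiag U a) v <= x * qf 1%:M v.
Proof.
move=> h le; rewrite qf_unidiag (qf1_unidiag _ h) mulr_sumr ler_sum // => i _.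
by rewrite ler_wpM2r ?sqnorm_ge0.
Qed.
Lemma qf_ge_unidiag N (U : 'M[C]_N) a x v : unimx U -> (forall i, x <= a i) ->
  x * qf 1%:M v <= qf (unidiag U a) v.
Proof.
move=> h le; rewrite qf_unidiag (qf1_unidiag _ h) mulr_sumr ler_sum // => i _.
by rewrite ler_wpM2r ?sqnorm_ge0.
Qed.
(** The columns of [U] are unit eigenvectors, at which the form takes the values [a i]. *)
Lemma unidiag_le_qf N (U : 'M[C]_N) a x : unimx U ->
  (forall v, qf (unidiag U a) v <= x * qf 1%:M v) -> forall i, a i <= x.
Proof. by move=> h le i; have := le (col i U); rewrite qf_unidiag_col // qf1_col // mulr1. Qed.
Lemma unidiag_ge_qf N (U : 'M[C]_N) a x : unimx U ->
  (forall v, x * qf 1%:M v <= qf (unidiag U a) v) -> forall i, x <= a i.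
Proof. by move=> h le i; have := le (col i U); rewrite qf_unidiag_col // qf1_col // mulr1. Qed.

End ComplexParts.

(** * Joint convexity of the relative entropy *)

Section RelEntropy.
Variable R : realType.
Local Notation C := R[i].
Local Notation re := (@complex.Re R).
Local Notation im := (@complex.Im R).

Lemma ln_le_sub1 (x : R) : 0 < x -> ln x <= x - 1.
Proof. move=> x0; have := @le_ln1Dx R (x - 1).
by rewrite (_ : 1 + (x - 1) = x); [apply; lra|ring]. Qed.

Definition mix (l a t : R) := (1 - l) * a + l * t.

Lemma mix_gt0 l a t : 0 <= l <= 1 -> 0 < a -> 0 < t -> 0 < mix l a t.
Proof.
move=> /andP[l0 l1] a0 t0; rewrite /mix.
have [->|ln0] := eqVneq l 0; first by rewrite subr0 mul1r mul0r addr0.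
rewrite ltr_wpDl ?mulr_ge0 ?subr_ge0 //; first exact: ltW.
by rewrite mulr_gt0 // lt0r ln0.
Qed.

(* [t (ln t - ln a)] is the integral of [log_integrand l a t] over [l] in [0, 1]. *)
Definition log_integrand (l a t : R) := t * (t - a) / mix l a t.

Section ScalarLog.
Variables (a t : R) (n : nat).
Hypotheses (a0 : 0 < a) (t0 : 0 < t) (n0 : (0 < n)%N).
Let l k : R := k%:R / n%:R.
Let y k := mix (l k) a t.

Let nR : 0 < n%:R :> R. Proof. by rewrite ltr0n. Qed.

Let l01 k : (k <= n)%N -> 0 <= l k <= 1.
Proof.
by move=> kn; rewrite /l divr_ge0 ?ler0n //= ler_pdivrMr // mul1r ler_nat.
Qed.

Let yS k : y k.+1 = y k + (t - a) / n%:R.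
Proof. by rewrite /y /mix /l -natr1; field; rewrite gt_eqF. Qed.

Let y0 : y 0%N = a. Proof. by rewrite /y /l /mix; ring. Qed.
Let yn : y n = t. Proof. by rewrite /y /l /mix; field; rewrite gt_eqF. Qed.
Let ygt0 k : (k <= n)%N -> 0 < y k. Proof. by move=> /l01 h; apply: mix_gt0. Qed.

Let lnE : ln t - ln a = \sum_(0 <= k < n) (ln (y k.+1) - ln (y k)).
Proof. by rewrite telescope_sumr // y0 yn. Qed.

(** The nodes [y k] run evenly from [a] to [t]. Between neighbours, [ln x <= x - 1] at
    [x = y k / y k.+1] shows that the right-endpoint sum underestimates the integral of [1 / y],
    whichever of [a] and [t] is larger. *)
Lemma ln_riemann_ge :
  \sum_(0 <= k < n) log_integrand (l k.+1) a t / n%:R <= t * (ln t - ln a).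
Proof.
rewrite lnE mulr_sumr !big_nat; apply: ler_sum => k /andP[_ kn].
rewrite /log_integrand -/(y k.+1) -!mulrA ler_pM2l //.
have k0 := ygt0 (ltnW kn); have k1 := ygt0 kn.
have : ln (y k / y k.+1) <= y k / y k.+1 - 1 by apply: ln_le_sub1; rewrite divr_gt0.
rewrite lnM ?posrE ?invr_gt0 // lnV ?posrE //.
have -> : (t - a) * ((y k.+1)^-1 / n%:R) = 1 - y k / y k.+1.
  have -> : y k = y k.+1 - (t - a) / n%:R by rewrite yS addrK.
  by field; rewrite !gt_eqF.
lra.
Qed.

(** The same inequality at the inverse ratio gives the left-endpoint sum as an upper bound. The two
    sums differ by a telescoping sum, which is the error term. *)
Lemma ln_riemann_le :
  t * (ln t - ln a) <=
  \sum_(0 <= k < n) log_integrand (l k.+1) a t / n%:R + (t - a) ^+ 2 / a / n%:R.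
Proof.
have -> : (t - a) ^+ 2 / a / n%:R =
   \sum_(0 <= k < n) (- (t * (t - a) / n%:R / y k.+1) + t * (t - a) / n%:R / y k).
  rewrite (eq_bigr (fun k => - (t * (t - a) / n%:R / y k.+1) -
     - (t * (t - a) / n%:R / y k))); last by move=> k _; rewrite opprK.
  rewrite (telescope_sumr (fun k => - (t * (t - a) / n%:R / y k))) // y0 yn.
  by field; rewrite !gt_eqF.
rewrite -big_split /= lnE mulr_sumr !big_nat; apply: ler_sum => k /andP[_ kn].
rewrite /log_integrand -/(y k.+1).
have k0 := ygt0 (ltnW kn); have k1 := ygt0 kn.
have : ln (y k.+1 / y k) <= y k.+1 / y k - 1 by apply: ln_le_sub1; rewrite divr_gt0.
rewrite lnM ?posrE ?invr_gt0 // lnV ?posrE // => h.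
have -> : t * (t - a) / y k.+1 / n%:R
    + (- (t * (t - a) / n%:R / y k.+1) + t * (t - a) / n%:R / y k) =
    t * (y k.+1 / y k - 1).
  have -> : t - a = n%:R * (y k.+1 - y k) by rewrite yS; field; rewrite gt_eqF.
  by field; rewrite !gt_eqF.
by rewrite ler_pM2l.
Qed.
End ScalarLog.

(* [Tr T (ln T - ln A)] for [T = V diag(t) V^*] and [A = U diag(a) U^*]. *)
Definition relent N (V : 'M[C]_N) t (U : 'M[C]_N) a : R :=
  \sum_i \sum_j overlap U V i j * (t j * (ln (t j) - ln (a i))).

(* [<A, M^-1 A>] where [M Y = (1 - l) A Y + l Y T], with [A] and [T] as above. *)
Definition quad_overlap N (U : 'M[C]_N) a (V : 'M[C]_N) t l : R :=
  \sum_i \sum_j overlap U V i j * (a i ^+ 2 / mix l (a i) (t j)).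

(* [Tr (supA l Y A) + Tr (supT l Y T)] has real part [2 Re <Y, A> - <Y, M Y>],
   whose supremum over [Y] is [<A, M^-1 A>], attained at [optY]. *)
Definition supA N l (Y : 'M[C]_N) : 'M[C]_N :=
  2%:C%C *: ctrmx Y + (- (1 - l))%:C%C *: (Y *m ctrmx Y).
Definition supT N l (Y : 'M[C]_N) : 'M[C]_N := (- l)%:C%C *: (ctrmx Y *m Y).

(** The operator [M] is diagonal on pairs of eigenvectors, so [M Y = A] is solved entry by entry. *)
Definition optY N (U : 'M[C]_N) a (V : 'M[C]_N) t l : 'M[C]_N :=
  U *m (\matrix_(i, j) ((a i / mix l (a i) (t j))%:C%C * (ctrmx U *m V) i j)) *m ctrmx V.

Lemma rtr_supA N l (Y M : 'M[C]_N) :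
  rtr (supA l Y *m M) = 2 * rtr (ctrmx Y *m M) + (- (1 - l)) * rtr (Y *m ctrmx Y *m M).
Proof. by rewrite mulmxDl rtrD -!scalemxAl !rtrZ. Qed.

Lemma rtr_supT N l (Y M : 'M[C]_N) :
  rtr (supT l Y *m M) = - l * rtr (ctrmx Y *m Y *m M).
Proof. by rewrite -scalemxAl rtrZ. Qed.

(* In the bases U and V the left-hand side decouples into the terms
   2 Re (y^* a w) - m |y|^2 over the entries y of U^* Y V, with w those of U^* V. *)
Lemma sup_entries N (U V Y : 'M[C]_N) a t l : unimx U -> unimx V ->
  let y := ctrmx U *m Y *m V in
  rtr (supA l Y *m unidiag U a) + rtr (supT l Y *m unidiag V t) =
  \sum_i \sum_j (2 * (a i * re ((y i j)^*%C * (ctrmx U *m V) i j))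
                 - mix l (a i) (t j) * sqnorm (y i j)).
Proof.
move=> hU hV y.
have UU := unimxr hU; have VV := unimxr hV.
have YE : Y = U *m y *m ctrmx V.
  by rewrite /y !mulmxA UU mul1mx -mulmxA VV mulmx1.
clearbody y.
have e1 : rtr (ctrmx Y *m unidiag U a) =
    \sum_i \sum_j a i * re ((y i j)^*%C * (ctrmx U *m V) i j).
  rewrite YE !ctrmxM ctrmxK /unidiag.
  rewrite (_ : _ *m _ = V *m (ctrmx y *m (rdiag a *m ctrmx U))); last first.
    by rewrite -!mulmxA (mulmxA (ctrmx U) U) hU mul1mx.
  rewrite /rtr mxtrace_mulC -!mulmxA /mxtrace re_sum.
  rewrite [RHS]exchange_big /=; apply: eq_bigr => j _.
  rewrite mxE re_sum; apply: eq_bigr => i _.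
  rewrite mul_rdiag; have -> : (ctrmx y) j i = (y i j)^*%C by rewrite mxE mxE.
  by rewrite mulrCA reZ.
have e2 : rtr (Y *m ctrmx Y *m unidiag U a) = \sum_i \sum_j a i * sqnorm (y i j).
  transitivity (rtr (rdiag a *m y *m rdiag (fun=> 1) *m ctrmx y)).
    rewrite rdiag1 mulmx1 YE !ctrmxM ctrmxK /unidiag /rtr.
    rewrite (_ : _ *m _ = U *m (y *m ctrmx y *m rdiag a *m ctrmx U)); last first.
      rewrite -!mulmxA (mulmxA (ctrmx V) V) hV mul1mx.
      by rewrite (mulmxA (ctrmx U) U) hU mul1mx.
    rewrite mxtrace_mulC -!mulmxA hU mulmx1.
    by rewrite [in RHS]mxtrace_mulC -!mulmxA.
  rewrite rtr_rdiag2; apply: eq_bigr => i _; apply: eq_bigr => j _.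
  by rewrite mulr1.
have e3 : rtr (ctrmx Y *m Y *m unidiag V t) = \sum_i \sum_j t j * sqnorm (y i j).
  transitivity (rtr (rdiag (fun=> 1) *m y *m rdiag t *m ctrmx y)).
    rewrite rdiag1 mul1mx YE !ctrmxM ctrmxK /unidiag /rtr.
    rewrite (_ : _ *m _ = V *m (ctrmx y *m y *m rdiag t *m ctrmx V)); last first.
      rewrite -!mulmxA (mulmxA (ctrmx U) U) hU mul1mx.
      by rewrite (mulmxA (ctrmx V) V) hV mul1mx.
    by rewrite mxtrace_mulC -!mulmxA hV mulmx1 mxtrace_mulC -!mulmxA.
  rewrite rtr_rdiag2; apply: eq_bigr => i _; apply: eq_bigr => j _.
  by rewrite mul1r.
have eA := rtr_supA l Y (unidiag U a); have eT := rtr_supT l Y (unidiag V t).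
rewrite e1 e2 in eA; rewrite e3 in eT.
transitivity (2 * (\sum_i \sum_j a i * re ((y i j)^*%C * (ctrmx U *m V) i j)) +
    - (1 - l) * (\sum_i \sum_j a i * sqnorm (y i j)) +
    - l * (\sum_i \sum_j t j * sqnorm (y i j))); first by rewrite -eA -eT.
rewrite !mulr_sumr -!big_split /=; apply: eq_bigr => i _.
rewrite !mulr_sumr -!big_split /=; apply: eq_bigr => j _.
by rewrite /mix; ring.
Qed.

(** Completing the square: the two sides differ by [|b w - m y|^2 / m]. *)
Lemma quad_over_lin (m b : R) (y w : C) : 0 < m ->
  2 * (b * re (y^*%C * w)) - m * sqnorm y <= sqnorm w * (b ^+ 2 / m).
Proof.
move=> m0; case: y w => [p q] [r s]; rewrite /sqnorm /= -subr_ge0.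
have -> : (r ^+ 2 + s ^+ 2) * (b ^+ 2 / m)
   - (2 * (b * (p * r - (- q) * s)) - m * (p ^+ 2 + q ^+ 2)) =
   ((b * r - m * p) ^+ 2 + (b * s - m * q) ^+ 2) / m.
  by field; rewrite gt_eqF.
by rewrite divr_ge0 ?addr_ge0 ?sqr_ge0 // ltW.
Qed.

Lemma quad_over_lin_eq (m b : R) (w : C) : 0 < m -> let y := (b / m)%:C%C * w in
  2 * (b * re (y^*%C * w)) - m * sqnorm y = sqnorm w * (b ^+ 2 / m).
Proof.
move=> m0; case: w => [r s]; rewrite /sqnorm /=.
by field; rewrite gt_eqF.
Qed.

Lemma sup_le_quad_overlap N (U V Y : 'M[C]_N) a t l : unimx U -> unimx V ->
  0 <= l <= 1 -> (forall i, 0 < a i) -> (forall i, 0 < t i) ->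
  rtr (supA l Y *m unidiag U a) + rtr (supT l Y *m unidiag V t) <= quad_overlap U a V t l.
Proof.
move=> hU hV l01 a0 t0; rewrite sup_entries //.
apply: ler_sum => i _; apply: ler_sum => j _.
by apply: quad_over_lin; apply: mix_gt0.
Qed.

Lemma sup_optY N (U V : 'M[C]_N) a t l : unimx U -> unimx V ->
  0 <= l <= 1 -> (forall i, 0 < a i) -> (forall i, 0 < t i) ->
  let Y := optY U a V t l in
  rtr (supA l Y *m unidiag U a) + rtr (supT l Y *m unidiag V t) = quad_overlap U a V t l.
Proof.
move=> hU hV l01 a0 t0 Y; rewrite sup_entries //.
apply: eq_bigr => i _; apply: eq_bigr => j _.
have m0 := mix_gt0 l01 (a0 i) (t0 j); rewrite /overlap.
have -> : (ctrmx U *m Y *m V) i j =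
   (a i / mix l (a i) (t j))%:C%C * (ctrmx U *m V) i j.
  rewrite /Y /optY !mulmxA hU mul1mx -mulmxA hV mulmx1.
  by rewrite mxE.
exact: quad_over_lin_eq.
Qed.

(** Substituting [t = (m - (1 - l) a) / l] with [m = mix l a t] and dividing by [m] isolates a part
    linear in [(T, A)] and a quadratic-over-linear part with the nonnegative factor [1 - l]. The
    factor [l ^- 2] excludes [l = 0], which is why the Riemann sums use right endpoints. *)
Lemma log_integrand_split N (U V : 'M[C]_N) a t l : unimx U -> unimx V ->
  0 < l <= 1 -> (forall i, 0 < a i) -> (forall i, 0 < t i) ->
  \sum_i \sum_j overlap U V i j * log_integrand l (a i) (t j) =
  l ^- 2 * (l * rtr (unidiag V t) - rtr (unidiag U a) + (1 - l) * quad_overlap U a V t l).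
Proof.
move=> hU hV /andP[l0 l1] a0 t0.
rewrite (rtr_unidiag_overlap_r _ hU hV) (rtr_unidiag_overlap_l _ hU hV) /quad_overlap.
rewrite !mulr_sumr -sumrB -big_split mulr_sumr /=; apply: eq_bigr => i _.
rewrite !mulr_sumr -sumrB -big_split mulr_sumr /=; apply: eq_bigr => j _.
have m0 : 0 < mix l (a i) (t j) by apply: mix_gt0 => //; rewrite ltW.
rewrite /log_integrand.
have -> : t j = (mix l (a i) (t j) - (1 - l) * a i) / l.
  by rewrite /mix; field; rewrite gt_eqF.
move: m0; set m := mix l (a i) (t j) => m0.
have -> : mix l (a i) ((m - (1 - l) * a i) / l) = m.
  by rewrite /mix; field; rewrite gt_eqF.
by field; rewrite !gt_eqF.
Qed.

(** [stepT] and [stepA] are the coefficients of [T] and [A] in one term of the Riemann sum, once the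
    supremum in [log_integrand_split] is replaced by its value at [Y]; [c] collects [l ^- 2] and the
    mesh. *)
Definition stepT N c l (Y : 'M[C]_N) : 'M[C]_N :=
  c%:C%C *: (l%:C%C *: 1%:M + (1 - l)%:C%C *: supT l Y).
Definition stepA N c l (Y : 'M[C]_N) : 'M[C]_N :=
  c%:C%C *: ((-1)%:C%C *: 1%:M + (1 - l)%:C%C *: supA l Y).

Lemma rtr_comb N (x y z : R) (B M : 'M[C]_N) :
  rtr (x%:C%C *: (y%:C%C *: 1%:M + z%:C%C *: B) *m M) =
  x * (y * rtr M + z * rtr (B *m M)).
Proof. by rewrite -scalemxAl rtrZ mulmxDl rtrD -!scalemxAl !rtrZ mul1mx. Qed.

Lemma rtr_step N c l (Y A T : 'M[C]_N) :
  rtr (stepT c l Y *m T) + rtr (stepA c l Y *m A) =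
  c * (l * rtr T - rtr A + (1 - l) * (rtr (supA l Y *m A) + rtr (supT l Y *m T))).
Proof.
transitivity (c * (l * rtr T + (1 - l) * rtr (supT l Y *m T)) +
    c * (-1 * rtr A + (1 - l) * rtr (supA l Y *m A))).
  by congr (_ + _); exact: rtr_comb.
by move: (rtr _) (rtr _) (rtr _) (rtr _) => w x y z; ring.
Qed.

Lemma rtr_sum_mul N (I : Type) (r : seq I) (F : I -> 'M[C]_N) M :
  rtr ((\sum_(i <- r) F i) *m M) = \sum_(i <- r) rtr (F i *m M).
Proof. by rewrite mulmx_suml rtr_sum. Qed.

(* Joint convexity in the form of approximate supporting linear functionals. *)
Lemma relent_support N (U0 V0 : 'M[C]_N) a0 t0 : unimx U0 -> unimx V0 ->
  (forall i, 0 < a0 i) -> (forall i, 0 < t0 i) -> forall e : R, 0 < e ->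
  exists K F : 'M[C]_N,
    (forall U V a t, unimx U -> unimx V ->
       (forall i, 0 < a i) -> (forall i, 0 < t i) ->
       rtr (K *m unidiag V t) + rtr (F *m unidiag U a) <= relent V t U a) /\
    relent V0 t0 U0 a0 <= rtr (K *m unidiag V0 t0) + rtr (F *m unidiag U0 a0) + e.
Proof.
move=> hU0 hV0 a00 t00 e e0.
(* By [ln_riemann_le], [D / n] is the total error of the Riemann sums at the base point; hence the
   choice of [n]. *)
pose D := \sum_i \sum_j overlap U0 V0 i j * ((t0 j - a0 i) ^+ 2 / a0 i).
have D0 : 0 <= D.
  apply: sumr_ge0 => i _; apply: sumr_ge0 => j _.
  by rewrite mulr_ge0 ?overlap_ge0 // divr_ge0 ?sqr_ge0 // ltW.
pose n := (Num.truncn (D / e)).+1.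
have nN : (0 < n)%N by [].
have n0 : 0 < n%:R :> R by rewrite ltr0n.
have Dn : D / n%:R <= e.
  rewrite ler_pdivrMr // mulrC -ler_pdivrMr //; apply: ltW.
  by rewrite /n truncnS_gt.
clearbody n.
have [l lE] : exists l : nat -> R, forall k, l k = k.+1%:R / n%:R.
  by exists (fun k => k.+1%:R / n%:R).
have l01 k : (k < n)%N -> 0 < l k <= 1.
  by move=> kn; rewrite lE divr_gt0 ?ltr0n //= ler_pdivrMr // mul1r ler_nat.
(* Each [Y k] is optimal at the base point and merely admissible elsewhere: near-equality there, a
   lower bound everywhere. *)
pose Y k := optY U0 a0 V0 t0 (l k).
pose K k := stepT (l k ^- 2 / n%:R) (l k) (Y k).
pose F k := stepA (l k ^- 2 / n%:R) (l k) (Y k).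
have relE U V a t :
   \sum_(0 <= k < n) (\sum_i \sum_j overlap U V i j * log_integrand (l k) (a i) (t j)) / n%:R
   = \sum_i \sum_j overlap U V i j * \sum_(0 <= k < n) log_integrand (l k) (a i) (t j) / n%:R.
  transitivity (\sum_(0 <= k < n) \sum_i \sum_j
      overlap U V i j * (log_integrand (l k) (a i) (t j) / n%:R)).
    apply: eq_bigr => k _; rewrite mulr_suml; apply: eq_bigr => i _.
    by rewrite mulr_suml; apply: eq_bigr => j _; rewrite mulrA.
  rewrite exchange_big /=; apply: eq_bigr => i _.
  by rewrite exchange_big /=; apply: eq_bigr => j _; rewrite mulr_sumr.
exists (\sum_(0 <= k < n) K k), (\sum_(0 <= k < n) F k); split.
  move=> U V a t hU hV a1 t1.
  apply: (@le_trans _ _ (\sum_i \sum_j overlap U V i j *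
            \sum_(0 <= k < n) log_integrand (l k) (a i) (t j) / n%:R)); last first.
    apply: ler_sum => i _; apply: ler_sum => j _.
    by rewrite ler_wpM2l ?overlap_ge0 //; under eq_bigr do rewrite lE; exact: ln_riemann_ge.
  rewrite -relE !rtr_sum_mul -big_split /= !big_nat.
  apply: ler_sum => k /andP[_ /l01 lk]; have /andP[lk0 lk1] := lk.
  rewrite rtr_step log_integrand_split // -[leRHS]mulrAC.
  rewrite ler_wpM2l // ?divr_ge0 ?invr_ge0 ?sqr_ge0 ?ler0n //.
  rewrite lerD2l ler_wpM2l ?subr_ge0 //.
  by apply: sup_le_quad_overlap => //; rewrite ltW.
apply: (@le_trans _ _ (\sum_i \sum_j overlap U0 V0 i j *
     (\sum_(0 <= k < n) log_integrand (l k) (a0 i) (t0 j) / n%:R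
       + (t0 j - a0 i) ^+ 2 / a0 i / n%:R))).
  apply: ler_sum => i _; apply: ler_sum => j _.
  by rewrite ler_wpM2l ?overlap_ge0 //; under eq_bigr do rewrite lE; exact: ln_riemann_le.
rewrite (_ : \sum_i _ = \sum_i \sum_j overlap U0 V0 i j *
     (\sum_(0 <= k < n) log_integrand (l k) (a0 i) (t0 j) / n%:R) + D / n%:R); last first.
  rewrite /D mulr_suml -big_split /=; apply: eq_bigr => i _.
  rewrite mulr_suml -big_split /=; apply: eq_bigr => j _.
  by rewrite mulrDr !mulrA.
apply: lerD => //.
rewrite -relE !rtr_sum_mul -big_split /= !big_nat.
apply: ler_sum => k /andP[_ /l01 lk]; have /andP[lk0 lk1] := lk.
rewrite rtr_step log_integrand_split // -[leLHS]mulrAC sup_optY //.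
by rewrite ltW.
Qed.

(** All terms become sums weighted by overlaps; then [ln x <= x - 1] at [x = expR b / t] suffices
    for each pair of eigenvalues. *)
Lemma klein N (V W : 'M[C]_N) t b : unimx V -> unimx W -> (forall i, 0 < t i) ->
  \sum_j t j - \sum_i expR (b i) <= \sum_j t j * ln (t j) - rtr (unidiag W b *m unidiag V t).
Proof.
move=> hV hW t0; rewrite rtr_unidiag2.
rewrite -(rtr_unidiag (fun j => t j) hV) -(rtr_unidiag (fun i => expR (b i)) hW).
rewrite -(rtr_unidiag (fun j => t j * ln (t j)) hV).
rewrite !(rtr_unidiag_overlap_r _ hW hV) (rtr_unidiag_overlap_l _ hW hV) -!sumrB.
apply: ler_sum => i _; rewrite -!sumrB; apply: ler_sum => j _.
rewrite -!mulrBl ler_wpM2r ?overlap_ge0 //.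
have : ln (expR (b i) / t j) <= expR (b i) / t j - 1.
  by apply: ln_le_sub1; rewrite divr_gt0 ?expR_gt0.
rewrite lnM ?posrE ?invr_gt0 ?expR_gt0 // lnV ?posrE // expRK => h.
have : t j * (b i - ln (t j)) <= t j * (expR (b i) / t j - 1) by rewrite ler_pM2l.
have -> : t j * (expR (b i) / t j - 1) = expR (b i) - t j by field; rewrite gt_eqF.
by lra.
Qed.

End RelEntropy.

(** * Random matrices *)

Section RandomMatrix.
Variable R : realType.
Local Notation C := R[i].
Local Notation re := (@complex.Re R).
Local Notation im := (@complex.Im R).

(** * Measurability of the matrix exponential *)

Section Measurability.
Context (d : measure_display) (T : measurableType d).

Definition mxmeas m n (X : T -> 'M[C]_(m, n)) : Prop :=
  forall i j, measurable_fun setT (fun w => re (X w i j)) /\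
              measurable_fun setT (fun w => im (X w i j)).

Lemma mxmeas_cst m n (A : 'M[C]_(m, n)) : mxmeas (fun=> A).
Proof. by move=> i j; split; exact: measurable_cst. Qed.

Lemma mxmeasD m n (X Y : T -> 'M[C]_(m, n)) : mxmeas X -> mxmeas Y ->
  mxmeas (fun w => X w + Y w).
Proof.
move=> mX mY i j; have [x1 x2] := mX i j; have [y1 y2] := mY i j; split.
  by under eq_fun do rewrite mxE reD; exact: measurable_funD.
by under eq_fun do rewrite mxE imD; exact: measurable_funD.
Qed.

Lemma mxmeas_sum m n I (r : seq I) (X : I -> T -> 'M[C]_(m, n)) :
  (forall k, mxmeas (X k)) -> mxmeas (fun w => \sum_(k <- r) X k w).
Proof.
move=> mX; elim: r => [|k r IH].
  by under eq_fun do rewrite big_nil; exact: mxmeas_cst.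
by under eq_fun do rewrite big_cons; exact: mxmeasD.
Qed.

Lemma mxmeasM m n p (X : T -> 'M[C]_(m, n)) (Y : T -> 'M[C]_(n, p)) :
  mxmeas X -> mxmeas Y -> mxmeas (fun w => X w *m Y w).
Proof.
move=> mX mY i j; split.
  under eq_fun do rewrite mxE re_sum.
  apply: measurable_sum => k; under eq_fun do rewrite reM.
  have [x1 x2] := mX i k; have [y1 y2] := mY k j.
  by apply: measurable_funB; exact: measurable_funM.
under eq_fun do rewrite mxE im_sum.
apply: measurable_sum => k; under eq_fun do rewrite imM.
have [x1 x2] := mX i k; have [y1 y2] := mY k j.
by apply: measurable_funD; exact: measurable_funM.
Qed.

Lemma mxmeasZ m n (a : R) (X : T -> 'M[C]_(m, n)) : mxmeas X ->
  mxmeas (fun w => a%:C%C *: X w).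
Proof.
move=> mX i j; have [x1 x2] := mX i j; split.
  by under eq_fun do rewrite mxE reZ; exact: measurable_funM.
by under eq_fun do rewrite mxE imZ; exact: measurable_funM.
Qed.

Lemma mxmeasX n (X : T -> 'M[C]_n) k : mxmeas X -> mxmeas (fun w => X w ^+ k).
Proof.
move=> mX; elim: k => [|k IH]; first exact: mxmeas_cst.
by under eq_fun do rewrite exprS; exact: mxmeasM.
Qed.

Lemma measurable_rtr n (X : T -> 'M[C]_n) : mxmeas X ->
  measurable_fun setT (fun w => rtr (X w)).
Proof.
move=> mX; under eq_fun do rewrite /rtr /mxtrace re_sum.
by apply: measurable_sum => k; case: (mX k k).
Qed.

Lemma mxmeas_cvg m n (Y : nat -> T -> 'M[C]_(m, n)) (X : T -> 'M[C]_(m, n)) :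
  (forall k, mxmeas (Y k)) ->
  (forall w i j, (re (Y k w i j) @[k --> \oo] --> re (X w i j)) /\
                 (im (Y k w i j) @[k --> \oo] --> im (X w i j))) ->
  mxmeas X.
Proof.
move=> mY cY i j; split.
  apply: (@measurable_fun_cvg _ _ _ _ (fun k w => re (Y k w i j))).
    by move=> k; case: (mY k i j).
  by move=> w _; case: (cY w i j).
apply: (@measurable_fun_cvg _ _ _ _ (fun k w => im (Y k w i j))).
  by move=> k; case: (mY k i j).
by move=> w _; case: (cY w i j).
Qed.

Lemma unidiagE N (U : 'M[C]_N) a i j :
  unidiag U a i j = \sum_k (a k)%:C%C * (U i k * (U j k)^*%C).
Proof.
rewrite mxE; apply: eq_bigr => k _.
by rewrite mul_mxrdiag !mxE; ring.
Qed.

Lemma unidiagD N (U : 'M[C]_N) a b : unidiag U a + unidiag U b = unidiag U (fun i => a i + b i).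
Proof.
apply/matrixP=> i j; rewrite mxE !unidiagE -big_split /=; apply: eq_bigr => k _.
by rewrite rmorphD mulrDl.
Qed.

Lemma unidiagZ N (U : 'M[C]_N) (x : R) a : x%:C%C *: unidiag U a = unidiag U (fun i => x * a i).
Proof.
apply/matrixP=> i j; rewrite mxE !unidiagE mulr_sumr; apply: eq_bigr => k _.
by rewrite rmorphM mulrA.
Qed.

Lemma unidiag0 N (U : 'M[C]_N) : unidiag U (fun=> 0) = 0.
Proof. by apply/matrixP=> i j; rewrite unidiagE mxE big1 // => k _; rewrite mul0r. Qed.

Lemma unidiag_sum N (U : 'M[C]_N) I (r : seq I) (a : I -> 'I_N -> R) :
  \sum_(k <- r) unidiag U (a k) = unidiag U (fun i => \sum_(k <- r) a k i).
Proof.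
elim: r => [|k r IH].
  by rewrite big_nil -(unidiag0 U); congr unidiag; apply/funext => i; rewrite big_nil.
rewrite big_cons IH unidiagD; congr unidiag; apply/funext => i; by rewrite big_cons.
Qed.

Lemma unidiagX N (U : 'M[C]_N) a k : unimx U -> unidiag U a ^+ k = unidiag U (fun i => a i ^+ k).
Proof.
move=> hU; elim: k => [|k IH].
  by rewrite expr0 -[LHS](unidiag1 hU).
transitivity (unidiag U a *m unidiag U (fun i => a i ^+ k)); first by rewrite exprS IH.
by rewrite (unidiagM a _ hU); congr unidiag; apply/funext => i; rewrite exprS.
Qed.

Lemma unidiag_cvg N (U : 'M[C]_N) (a : nat -> 'I_N -> R) b i j :
  (forall k, a n k @[n --> \oo] --> b k) ->
  (re (unidiag U (a n) i j) @[n --> \oo] --> re (unidiag U b i j)) /\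
  (im (unidiag U (a n) i j) @[n --> \oo] --> im (unidiag U b i j)).
Proof.
move=> ab; split.
  rewrite unidiagE re_sum; under eq_fun do rewrite unidiagE re_sum.
  apply: cvg_big => [|k _]; first exact: add_continuous.
  by under eq_fun do rewrite reZ; rewrite reZ; apply: cvgMl.
rewrite unidiagE im_sum; under eq_fun do rewrite unidiagE im_sum.
apply: cvg_big => [|k _]; first exact: add_continuous.
by under eq_fun do rewrite imZ; rewrite imZ; apply: cvgMl.
Qed.

(** Partial sums of the exponential series are polynomials in [X w], hence measurable, and they
    converge entrywise because they converge on each eigenvalue. *)
Lemma mxmeas_exp N (X : T -> 'M[C]_N) (x : R) : (forall w, ctrmx (X w) = X w) ->
  mxmeas X -> mxmeas (fun w => hermfun (fun y => expR (x * y)) (X w)).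
Proof.
move=> hX mX.
apply: (@mxmeas_cvg _ _ (fun n w =>
   \sum_(0 <= k < n) (x ^+ k / k`!%:R)%:C%C *: X w ^+ k)).
  move=> n; apply: mxmeas_sum => k.
  by apply: mxmeasZ; apply: mxmeasX.
move=> w i j.
have E n : \sum_(0 <= k < n) (x ^+ k / k`!%:R)%:C%C *: X w ^+ k =
  unidiag (eigbasis (X w)) (fun i => series (exp_coeff (x * eigval (X w) i)) n).
  rewrite /series /= -unidiag_sum; apply: eq_bigr => k _.
  rewrite -[in LHS](spectral_decomp (hX w)) unidiagX ?unidiagZ; last exact: eigbasis_uni.
  by congr unidiag; apply/funext => a; rewrite /exp_coeff /= exprMn mulrAC.
have [c1 c2] := @unidiag_cvg _ (eigbasis (X w))
   (fun n i => series (exp_coeff (x * eigval (X w) i)) n)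
   ((fun y => expR (x * y)) \o eigval (X w)) i j (fun k => @is_cvg_series_exp_coeff _ _).
by split; under eq_fun do rewrite E.
Qed.

Definition trexp N (M : 'M[C]_N) : R := rtr (hermfun (@expR R) M).

Lemma mxmeas_expR N (X : T -> 'M[C]_N) : (forall w, ctrmx (X w) = X w) ->
  mxmeas X -> mxmeas (fun w => hermfun (@expR R) (X w)).
Proof.
move=> hX mX; have := mxmeas_exp 1 hX mX; congr mxmeas; apply/funext => w.
by congr unidiag; apply/funext => i /=; rewrite mul1r.
Qed.

Lemma trexpE N (M : 'M[C]_N) : ctrmx M = M -> trexp M = \sum_i expR (eigval M i).
Proof. by move=> hM; rewrite /trexp rtr_unidiag //; exact: eigbasis_uni. Qed.

Lemma trexp_ge0 N (M : 'M[C]_N) : ctrmx M = M -> 0 <= trexp M.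
Proof. by move=> hM; rewrite trexpE //; apply: sumr_ge0 => i _; exact: expR_ge0. Qed.

Lemma measurable_trexp N (X : T -> 'M[C]_N) : (forall w, ctrmx (X w) = X w) ->
  mxmeas X -> measurable_fun setT (fun w => trexp (X w)).
Proof. by move=> hX mX; apply: measurable_rtr; exact: mxmeas_expR. Qed.

End Measurability.

(** * Means of bounded random matrices *)

Section Expectation.
Context (d : measure_display) (T : measurableType d) (P : probability T R).

(** Boundedness refers to no measure and gives integrability under every probability. *)
Definition bmeas (f : T -> R) :=
  measurable_fun setT f /\ exists M : R, forall w, `|f w| <= M.

Lemma bmeas_int f : bmeas f -> P.-integrable setT (EFin \o f).
Proof.
move=> [mf [M fM]]; apply: measurable_bounded_integrable => //.
  by rewrite (le_lt_trans (probability_le1 P measurableT)) ?ltry.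
exists M; split; first exact: num_real.
by move=> x Mx w _ /=; rewrite (le_trans (fM w)) // ltW.
Qed.

Lemma bmeas_cst (c : R) : bmeas (fun=> c).
Proof. by split; [exact: measurable_cst|exists `|c|]. Qed.

Lemma bmeasD f g : bmeas f -> bmeas g -> bmeas (fun w => f w + g w).
Proof.
move=> [mf [M fM]] [mg [M' gM]]; split; first exact: measurable_funD.
by exists (M + M') => w; rewrite (le_trans (ler_normD _ _)) // lerD.
Qed.

Lemma bmeasZ c f : bmeas f -> bmeas (fun w => c * f w).
Proof.
move=> [mf [M fM]]; split; first exact: measurable_funM.
by exists (`|c| * M) => w; rewrite normrM ler_wpM2l.
Qed.

Lemma bmeas_sum I (r : seq I) (f : I -> T -> R) :
  (forall i, bmeas (f i)) -> bmeas (fun w => \sum_(i <- r) f i w).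
Proof.
move=> h; elim: r => [|k r IH].
  by under eq_fun do rewrite big_nil; exact: bmeas_cst.
by under eq_fun do rewrite big_cons; exact: bmeasD.
Qed.

Definition Ex (f : T -> R) : R := fine 'E_P[f].

Lemma ExE f : Ex f = \int[P]_x f x.
Proof. by rewrite /Ex unlock. Qed.

Lemma Ex_cst c : Ex (fun=> c) = c.
Proof. rewrite ExE Rintegral_cst //.
rewrite (_ : fine _ = 1) ?mulr1 //.
exact: (congr1 fine (probability_setT P)). Qed.

Lemma ExD f g : bmeas f -> bmeas g -> Ex (fun w => f w + g w) = Ex f + Ex g.
Proof. by move=> bf bg; rewrite !ExE RintegralD //; exact: bmeas_int. Qed.

Lemma ExZ c f : bmeas f -> Ex (fun w => c * f w) = c * Ex f.
Proof. by move=> bf; rewrite !ExE RintegralZl //; exact: bmeas_int. Qed.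

Lemma Ex_sum I (r : seq I) (f : I -> T -> R) : (forall i, bmeas (f i)) ->
  Ex (fun w => \sum_(i <- r) f i w) = \sum_(i <- r) Ex (f i).
Proof.
move=> h; elim: r => [|k r IH].
  by under eq_fun do rewrite big_nil; rewrite Ex_cst big_nil.
under eq_fun do rewrite big_cons.
by rewrite ExD ?IH ?big_cons //; exact: bmeas_sum.
Qed.

Lemma Ex_le f g : bmeas f -> bmeas g -> (forall w, f w <= g w) -> Ex f <= Ex g.
Proof.
by move=> bf bg fg; rewrite !ExE le_Rintegral //; exact: bmeas_int.
Qed.

Definition Emx m n (X : T -> 'M[C]_(m, n)) : 'M[C]_(m, n) :=
  \matrix_(i, j) (Ex (fun w => re (X w i j)) +i* Ex (fun w => im (X w i j)))%C.

Definition mxbmeas m n (X : T -> 'M[C]_(m, n)) : Prop :=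
  forall i j, bmeas (fun w => re (X w i j)) /\ bmeas (fun w => im (X w i j)).

Lemma rtr_mulE N (K M : 'M[C]_N) : rtr (K *m M) =
  \sum_i \sum_j (re (K i j) * re (M j i) + (- im (K i j)) * im (M j i)).
Proof.
rewrite /rtr /mxtrace re_sum; apply: eq_bigr => i _.
by rewrite mxE re_sum; apply: eq_bigr => j _; rewrite reM mulNr.
Qed.

Lemma bmeas_rtr N (K : 'M[C]_N) X : mxbmeas X -> bmeas (fun w => rtr (K *m X w)).
Proof.
move=> bX; under eq_fun do rewrite rtr_mulE.
apply: bmeas_sum => i; apply: bmeas_sum => j.
by have [b1 b2] := bX j i; apply: bmeasD; apply: bmeasZ.
Qed.

Lemma rtr_Emx N (K : 'M[C]_N) X : mxbmeas X ->
  rtr (K *m Emx X) = Ex (fun w => rtr (K *m X w)).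
Proof.
move=> bX; rewrite rtr_mulE; under [X in _ = Ex X]eq_fun do rewrite rtr_mulE.
rewrite Ex_sum; last first.
  move=> i; apply: bmeas_sum => j.
  by have [b1 b2] := bX j i; apply: bmeasD; apply: bmeasZ.
apply: eq_bigr => i _; rewrite Ex_sum; last first.
  by move=> j; have [b1 b2] := bX j i; apply: bmeasD; apply: bmeasZ.
apply: eq_bigr => j _; have [b1 b2] := bX j i.
by rewrite ExD ?ExZ ?mxE //; exact: bmeasZ.
Qed.

Lemma bmeas_qf N v X : @mxbmeas N N X -> bmeas (fun w => qf (X w) v).
Proof. by move=> bX; under eq_fun do rewrite qf_rtr; exact: bmeas_rtr. Qed.

Lemma qf_Emx N v X : @mxbmeas N N X -> qf (Emx X) v = Ex (fun w => qf (X w) v).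
Proof.
move=> bX; rewrite qf_rtr rtr_Emx //; congr Ex; apply/funext => w.
by rewrite qf_rtr.
Qed.

Lemma Emx_herm N (X : T -> 'M[C]_N) : mxbmeas X ->
  (forall w, ctrmx (X w) = X w) -> ctrmx (Emx X) = Emx X.
Proof.
move=> bX hX; apply/matrixP=> i j; rewrite !mxE /=.
have e w : X w i j = (X w j i)^*%C by rewrite -{1}hX !mxE.
congr (_ +i* _)%C; first by congr Ex; apply/funext => w; rewrite e; case: (X w j i).
rewrite -mulN1r -ExZ; last by case: (bX j i).
by congr Ex; apply/funext => w; rewrite e mulN1r; case: (X w j i).
Qed.

End Expectation.
End RandomMatrix.

(** * Lieb's theorem for one random summand *)

Section Lieb.
Variable R : realType.
Local Notation C := R[i].
Local Notation re := (@complex.Re R).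
Local Notation im := (@complex.Im R).

(** The tangent of the exponential at [t x] lies below it at [t] and at [0]. Averaging with weights
    [x] and [1 - x] cancels the slope. *)
Lemma expR_chord (t x : R) : 0 <= x <= 1 -> expR (t * x) <= 1 + (expR t - 1) * x.
Proof.
move=> /andP[x0 x1].
have e1 : expR (t * x) * (1 + (t - t * x)) <= expR t.
  rewrite -[X in _ <= expR X](subrKC (t * x)) expRD ler_pM2l ?expR_gt0 //.
  exact: expR_ge1Dx.
have e0 : expR (t * x) * (1 + (0 - t * x)) <= 1.
  rewrite -[X in _ <= X](@expR0 R) -[X in _ <= expR X](subrKC (t * x)) expRD.
  by rewrite ler_pM2l ?expR_gt0 // expR_ge1Dx.
have h1 := ler_wpM2l x0 e1.
have h0 : (1 - x) * (expR (t * x) * (1 + (0 - t * x))) <= (1 - x) * 1.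
  by rewrite ler_wpM2l // subr_ge0.
have -> : expR (t * x) = x * (expR (t * x) * (1 + (t - t * x))) +
   (1 - x) * (expR (t * x) * (1 + (0 - t * x))) by ring.
by lra.
Qed.

Lemma chord_gt0 (t x : R) : 0 <= x <= 1 -> 0 < 1 + (expR t - 1) * x.
Proof. by move=> h; apply: lt_le_trans (expR_chord t h); exact: expR_gt0. Qed.

Lemma ln_chord (t x : R) : 0 <= x <= 1 -> t * x <= ln (1 + (expR t - 1) * x).
Proof.
move=> h; rewrite -[leLHS]expRK ler_ln ?posrE ?expR_gt0 ?chord_gt0 //.
exact: expR_chord.
Qed.

Lemma uni_row_sqnorm N (U : 'M[C]_N) i : unimx U -> \sum_k sqnorm (U i k) = 1.
Proof.
move=> hU; have := congr1 (fun M : 'M[C]_N => re (M i i)) (unimxr hU).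
rewrite !mxE eqxx /= re_sum => <-; apply: eq_bigr => k _.
by rewrite !mxE mulrC conjM_sqnorm.
Qed.

Lemma re_im_le (x y : C) : `|re (x * y^*%C)| <= (sqnorm x + sqnorm y) / 2 /\
  `|im (x * y^*%C)| <= (sqnorm x + sqnorm y) / 2.
Proof.
case: x y => [a b] [p q]; rewrite /sqnorm /=.
have := sqr_ge0 (a - p); have := sqr_ge0 (a + p).
have := sqr_ge0 (b - q); have := sqr_ge0 (b + q).
have := sqr_ge0 (a - q); have := sqr_ge0 (a + q).
have := sqr_ge0 (b - p); have := sqr_ge0 (b + p).
by rewrite !ler_norml; split; apply/andP; split; nra.
Qed.

(** Each product of entries is at most the mean of their squared moduli, and the rows of [U] are
    unit vectors. *)
Lemma unidiag_bound N (U : 'M[C]_N) a (M : R) i j : unimx U -> (forall k, `|a k| <= M) ->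
  `|re (unidiag U a i j)| <= M /\ `|im (unidiag U a i j)| <= M.
Proof.
move=> hU aM.
have MS : \sum_k M * ((sqnorm (U i k) + sqnorm (U j k)) / 2) = M.
  rewrite -mulr_sumr -mulr_suml big_split /= !uni_row_sqnorm //; lra.
rewrite -MS unidiagE re_sum im_sum; split;
  apply: le_trans (ler_norm_sum _ _ _) _; apply: ler_sum => k _;
  rewrite ?reZ ?imZ normrM; apply: ler_pM => //; by case: (re_im_le (U i k) (U j k)).
Qed.

Lemma unidiag_affine N (U : 'M[C]_N) (c : R) a : unimx U ->
  1%:M + c%:C%C *: unidiag U a = unidiag U (fun i => 1 + c * a i).
Proof. by move=> hU; rewrite -{1}(unidiag1 hU) unidiagZ unidiagD. Qed.

Lemma eigval_bounds N (H : 'M[C]_N) x y : ctrmx H = H ->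
  (forall v, x * qf 1%:M v <= qf H v <= y * qf 1%:M v) ->
  forall i, x <= eigval H i <= y.
Proof.
move=> hH h i.
rewrite (unidiag_ge_qf (eigbasis_uni hH)) ?(unidiag_le_qf (eigbasis_uni hH)) // => v;
  by rewrite spectral_decomp //; case/andP: (h v).
Qed.

Lemma qf_eigval N (H : 'M[C]_N) x y : ctrmx H = H -> (forall i, x <= eigval H i <= y) ->
  forall v, x * qf 1%:M v <= qf H v <= y * qf 1%:M v.
Proof.
move=> hH h v; rewrite -(spectral_decomp hH).
rewrite qf_ge_unidiag ?qf_le_unidiag //; try exact: eigbasis_uni.
  by move=> i; case/andP: (h i).
by move=> i; case/andP: (h i).
Qed.

Context (d : measure_display) (T : measurableType d) (P : probability T R).

Lemma mxbmeas_unidiag N (X : T -> 'M[C]_N) (M : R) : mxmeas X ->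
  (forall w, exists U a, [/\ unimx U, X w = unidiag U a & forall k, `|a k| <= M]) -> mxbmeas X.
Proof.
move=> mX h i j; have [m1 m2] := mX i j.
by split; split=> //; exists M => w; have [U [a [hU -> aM]]] := h w;
  case: (unidiag_bound i j hU aM).
Qed.

Lemma mxbmeas01 N (X : T -> 'M[C]_N) : (forall w, ctrmx (X w) = X w) ->
  (forall w i, 0 <= eigval (X w) i <= 1) -> mxmeas X -> mxbmeas X.
Proof.
move=> hX X01 mX; apply: (@mxbmeas_unidiag _ _ 1) => // w.
exists (eigbasis (X w)), (eigval (X w)); split; [exact: eigbasis_uni|by rewrite spectral_decomp|move=> k].
by case/andP: (X01 w k) => ? ?; rewrite ger0_norm.
Qed.

Section Step.
Variables (N : nat) (H : 'M[C]_N) (X : T -> 'M[C]_N) (t : R).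
Hypotheses (hH : ctrmx H = H) (hX : forall w, ctrmx (X w) = X w)
  (X01 : forall w i, 0 <= eigval (X w) i <= 1) (mX : mxmeas X).

Let c := expR t - 1.
Let B w := H + t%:C%C *: X w.
Let Tm w := hermfun (@expR R) (B w).

Let hB w : ctrmx (B w) = B w. Proof. by rewrite ctrmxD ctrmxZ hX hH. Qed.
Let mB : mxmeas B. Proof. by apply: mxmeasD; [exact: mxmeas_cst|exact: mxmeasZ]. Qed.
(** Bounds the spectrum of [B w] uniformly in [w]. It makes [Tm] bounded and keeps the spectrum of
    its mean above [expR (- h)], so that the logarithm of [T0] makes sense. *)
Let h : R := \sum_i `|eigval H i| + `|t|.

Let Bh w i : - h <= eigval (B w) i <= h.
Proof.
apply: eigval_bounds => // v; rewrite /B qfD qfZ.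
have k0 := qf1_ge0 v.
have /andP[x0 x1] := qf_eigval (hX w) (X01 w) v.
rewrite mul0r mul1r in x0 x1.
have Hb j : - (\sum_i `|eigval H i|) <= eigval H j <= \sum_i `|eigval H i|.
  rewrite -ler_norml (bigD1 j) //= lerDl.
  by apply: sumr_ge0.
have /andP[y0 y1] := qf_eigval hH Hb v.
rewrite /h opprD mulrDl [X in _ <= _ <= X]mulrDl.
have t1 : `|t * qf (X w) v| <= `|t| * qf 1%:M v.
  by rewrite normrM (ger0_norm x0) ler_wpM2l.
move: t1; rewrite ler_norml => /andP[t1 t2].
by rewrite mulNr in y0 *; rewrite mulNr; apply/andP; split; apply: lerD.
Qed.

Let TmE w : Tm w = unidiag (eigbasis (B w)) (fun i => expR (eigval (B w) i)).
Proof. by []. Qed.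

Let bT : mxbmeas Tm.
Proof.
apply: (@mxbmeas_unidiag _ _ (expR h)); first exact: mxmeas_expR.
move=> w; exists (eigbasis (B w)), (fun i => expR (eigval (B w) i)); split=> //.
  exact: eigbasis_uni.
move=> k; rewrite ger0_norm ?expR_ge0 // ler_expR.
by case/andP: (Bh w k).
Qed.

Let bX : mxbmeas X. Proof. exact: mxbmeas01. Qed.

Lemma qf_Emx01 v : 0 <= qf (Emx P X) v <= qf 1%:M v.
Proof.
rewrite qf_Emx //; have b := bmeas_qf v bX.
have X1 w := qf_eigval (hX w) (X01 w) v.
rewrite -{1}(Ex_cst P 0) -(Ex_cst P (qf 1%:M v)).
by apply/andP; split; apply: Ex_le => // [|w]; try exact: bmeas_cst;
  case/andP: (X1 w); rewrite mul0r mul1r.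
Qed.

(** By [expR_chord] this dominates the matrix moment generating function [E exp (t X)]; unlike that
    function it is affine in the mean of [X]. *)
Definition mgf_mx := 1%:M + c%:C%C *: Emx P X.
Let A0 := mgf_mx.
Let T0 := Emx P Tm.

Let hE : ctrmx (Emx P X) = Emx P X. Proof. exact: Emx_herm. Qed.

Lemma mgf_mx_herm : ctrmx mgf_mx = mgf_mx.
Proof. by rewrite ctrmxD ctrmx1 ctrmxZ hE. Qed.

Lemma qf_mgf_mx v : qf mgf_mx v = qf 1%:M v + c * qf (Emx P X) v.
Proof. by rewrite qfD qfZ. Qed.

Lemma mgf_mx_gt0 i : 0 < eigval mgf_mx i.
Proof.
have h01 := eigval_bounds hE (fun v => _ : 0 * qf 1%:M v <= _ <= 1 * qf 1%:M v).
have {}h01 : forall i, 0 <= eigval (Emx P X) i <= 1.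
  by apply: h01 => v; rewrite mul0r mul1r; exact: qf_Emx01.
have e : mgf_mx = unidiag (eigbasis (Emx P X)) (fun i => 1 + c * eigval (Emx P X) i).
  by rewrite /mgf_mx -unidiag_affine ?spectral_decomp //; exact: eigbasis_uni.
have [m m0 mle] : exists2 m : R, 0 < m & forall i, m <= 1 + c * eigval (Emx P X) i.
  (* On [[0, 1]] the affine function [1 + c x] interpolates between [1] and [expR t]. *)
  exists (Num.min 1 (expR t)); first by rewrite lt_min ltr01 expR_gt0.
  move=> k; have /andP[k0 k1] := h01 k; rewrite ge_min /c.
  have [e1|e1] := leP 1 (expR t).
    by apply/orP; left; rewrite lerDl mulr_ge0 // subr_ge0.
  by apply/orP; right; nra.
apply: lt_le_trans m0 _; apply: (unidiag_ge_qf (eigbasis_uni mgf_mx_herm)) => v.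
rewrite spectral_decomp ?mgf_mx_herm // e; apply: qf_ge_unidiag => //; exact: eigbasis_uni.
Qed.

Let hT0 : ctrmx T0 = T0.
Proof. by apply: Emx_herm => // w; exact: hermfun_herm. Qed.

Let T0_gt0 i : 0 < eigval T0 i.
Proof.
apply: lt_le_trans (expR_gt0 (- h)) _; apply: (unidiag_ge_qf (eigbasis_uni hT0)) => v.
rewrite spectral_decomp // qf_Emx // -[leLHS](Ex_cst P).
apply: Ex_le; [exact: bmeas_cst|exact: bmeas_qf|move=> w].
rewrite TmE; apply: qf_ge_unidiag; first exact: eigbasis_uni.
by move=> k; rewrite ler_expR; case/andP: (Bh w k).
Qed.

(** [1 + c X] has the eigenbasis of [X w], so its logarithm is compared with [t X] by the scalar
    [ln_chord] on the eigenvalues of [X w], weighted by overlaps. *)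
Let relent_pointwise w :
  relent (eigbasis (B w)) (fun i => expR (eigval (B w) i))
         (eigbasis (X w)) (fun i => 1 + c * eigval (X w) i) <= rtr (H *m Tm w).
Proof.
have uB := eigbasis_uni (hB w); have uX := eigbasis_uni (hX w).
have HE : H = B w + (- t)%:C%C *: X w.
  by rewrite /B rmorphN scaleNr addrK.
have -> : rtr (H *m Tm w) = rtr (B w *m Tm w) + - t * rtr (X w *m Tm w).
  by rewrite {1}HE mulmxDl rtrD -scalemxAl rtrZ.
rewrite TmE.
have e1 M : B w *m M = unidiag (eigbasis (B w)) (eigval (B w)) *m M by rewrite spectral_decomp.
have e2 M : X w *m M = unidiag (eigbasis (X w)) (eigval (X w)) *m M by rewrite spectral_decomp.
rewrite e1 e2 unidiagM // rtr_unidiag2 (rtr_unidiag_overlap_r _ uX uB) mulr_sumr -big_split.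
apply: ler_sum => i _; rewrite mulr_sumr -big_split; apply: ler_sum => j _ /=.
rewrite expRK.
have -> : eigval (B w) j * expR (eigval (B w) j) * overlap (eigbasis (X w)) (eigbasis (B w)) i j +
  - t * (eigval (X w) i * expR (eigval (B w) j) * overlap (eigbasis (X w)) (eigbasis (B w)) i j) =
  overlap (eigbasis (X w)) (eigbasis (B w)) i j *
    (expR (eigval (B w) j) * (eigval (B w) j - t * eigval (X w) i)).
  by ring.
rewrite ler_wpM2l ?overlap_ge0 // ler_wpM2l ?expR_ge0 // lerD2l lerN2.
exact: ln_chord.
Qed.

(** Jensen's inequality without integrating the relative entropy: a supporting functional at the
    means lies pointwise below the entropy, hence below [rtr (H *m Tm w)], and both of these ends
    are affine in [(Tm w, X w)]. *)
Let relent_mean : relent (eigbasis T0) (eigval T0) (eigbasis A0) (eigval A0) <= rtr (H *m T0).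
Proof.
apply/ler_addgt0Pr => e e0.
have [K [F [KF KF0]]] :=
  relent_support (eigbasis_uni mgf_mx_herm) (eigbasis_uni hT0) mgf_mx_gt0 T0_gt0 e0.
apply: le_trans KF0 _; rewrite lerD2r !spectral_decomp ?mgf_mx_herm //.
have -> : rtr (F *m mgf_mx) = Ex P (fun w => rtr F + c * rtr (F *m X w)).
  rewrite ExD ?ExZ ?Ex_cst -?rtr_Emx //.
  - by rewrite mulmxDr mulmx1 -scalemxAr rtrD rtrZ.
  - exact: bmeas_rtr.
  - exact: bmeas_cst.
  - by apply: bmeasZ; exact: bmeas_rtr.
have b1 : bmeas (fun w => rtr F + c * rtr (F *m X w)).
  by apply: bmeasD; [exact: bmeas_cst|apply: bmeasZ; exact: bmeas_rtr].
rewrite !rtr_Emx // -ExD //; last exact: bmeas_rtr.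
apply: Ex_le; [|exact: bmeas_rtr|move=> w].
  by apply: bmeasD => //; exact: bmeas_rtr.
apply: le_trans (relent_pointwise w).
have := KF _ _ _ _ (eigbasis_uni (hX w)) (eigbasis_uni (hB w))
  (fun i => chord_gt0 t (X01 w i)) (fun i => expR_gt0 (eigval (B w) i)).
rewrite -TmE -unidiag_affine ?spectral_decomp //; last exact: eigbasis_uni.
by rewrite mulmxDr mulmx1 -scalemxAr rtrD rtrZ.
Qed.

Lemma bmeas_trexp : bmeas (fun w => trexp (H + t%:C%C *: X w)).
Proof.
by under eq_fun do rewrite /trexp -[hermfun _ _]mul1mx; exact: bmeas_rtr.
Qed.

(** Klein's inequality at [W = H + L] bounds [Tr T0 - Tr exp W] by the relative entropy of [T0] and
    [A0] minus [Tr H T0], which [relent_mean] makes nonpositive. *)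
Lemma lieb_step :
  Ex P (fun w => trexp (H + t%:C%C *: X w)) <= trexp (H + hermfun (@ln R) mgf_mx).
Proof.
set L := hermfun (@ln R) mgf_mx; set W := H + L.
have hW : ctrmx W = W by rewrite ctrmxD hH hermfun_herm.
have -> : Ex P (fun w => trexp (H + t%:C%C *: X w)) = \sum_i eigval T0 i.
  rewrite -(rtr_unidiag _ (eigbasis_uni hT0)) spectral_decomp // -[T0]mul1mx rtr_Emx //.
  by congr Ex; apply/funext => w; rewrite mul1mx.
rewrite trexpE //.
have := klein (eigval W) (eigbasis_uni hT0) (eigbasis_uni hW) T0_gt0.
have relE : relent (eigbasis T0) (eigval T0) (eigbasis A0) (eigval A0) =
    \sum_j eigval T0 j * ln (eigval T0 j) - rtr (L *m T0).
  have uT := eigbasis_uni hT0; have uA := eigbasis_uni mgf_mx_herm.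
  have -> : L *m T0 = L *m unidiag (eigbasis T0) (eigval T0) by rewrite spectral_decomp.
  rewrite rtr_unidiag2 -(rtr_unidiag _ uT) (rtr_unidiag_overlap_r _ uA uT) -sumrB.
  apply: eq_bigr => i _; rewrite -sumrB; apply: eq_bigr => j _ /=.
  by rewrite /A0; ring.
have := relent_mean; rewrite relE !spectral_decomp // mulmxDl rtrD.
by lra.
Qed.
End Step.
End Lieb.

(** * Decoupling independent summands *)

Section Decoupling.
Context (d : measure_display) (T : measurableType d) (R : realType) (P : probability T R).
Local Open Scope ereal_scope.

(** For fixed [B] both sides are finite measures in [A], the restriction of [P] to [B] and a
    multiple of [P], and they agree on a generating class closed under intersection. *)
Lemma indep_sigmal (G : set (set T)) (B : set T) :
  G `<=` measurable -> setI_closed G -> G setT -> measurable B ->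
  (forall A, G A -> P (A `&` B) = P A * P B) ->
  forall A, <<s G >> A -> P (A `&` B) = P A * P B.
Proof.
move=> Gm GI GT mB h A sA.
have fB : P B \is a fin_num by exact: fin_num_measure.
pose r : {nonneg R} := NngNum (fine_ge0 (measure_ge0 P B)).
have e : (mrestr P mB : {measure set T -> \bar R}) A =
         (mscale r P : {measure set T -> \bar R}) A.
  apply: (g_sigma_algebra_measure_unique G Gm (fun=> setT)) => //.
  - by rewrite bigcup_const.
  - move=> E GE; rewrite /= /mrestr /mscale h // /= fineK // muleC //.
  - move=> _; rewrite /= /mrestr setTI.
    by apply: le_lt_trans (probability_le1 P mB) _; exact: ltry.
by move: e; rewrite /= /mrestr /mscale /= fineK // muleC.
Qed.

Lemma indep_sigma (G1 G2 : set (set T)) :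
  G1 `<=` measurable -> setI_closed G1 -> G1 setT ->
  G2 `<=` measurable -> setI_closed G2 -> G2 setT ->
  (forall A B, G1 A -> G2 B -> P (A `&` B) = P A * P B) ->
  forall A B, <<s G1 >> A -> <<s G2 >> B -> P (A `&` B) = P A * P B.
Proof.
move=> m1 I1 T1 m2 I2 T2 h A B sA sB.
have mA : measurable A.
  by apply: (smallest_sub (@sigma_algebra_measurable _ T) m1).
rewrite setIC muleC; apply: (indep_sigmal m2) => // {}B {}sB.
rewrite setIC muleC; apply: (indep_sigmal m1) => //.
  exact: m2.
by move=> {mA} {sA} A sA; exact: h.
Qed.

(** The identity on points, with a smaller sigma-algebra on the target. The law of this map is [P]
    restricted to that sigma-algebra, a probability from which product measures can be formed. *)
Definition coarsen (G : set (set T)) (w : T) : g_sigma_algebraType G := w.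

Lemma measurable_coarsen (G : set (set T)) : G `<=` measurable ->
  measurable_fun setT (@coarsen G).
Proof.
move=> Gm _ Y mY; rewrite setTI.
exact: (smallest_sub (@sigma_algebra_measurable _ T) Gm).
Qed.

Section Coarse.
Variables (G : set (set T)) (Gm : G `<=` measurable).

(* The inclusion is an argument so that the measurability instance can refer to it. *)
Definition coarsen_rv (Gm : G `<=` measurable) : T -> g_sigma_algebraType G :=
  @coarsen G.
HB.instance Definition _ :=
  isMeasurableFun.Build _ _ _ _ (coarsen_rv Gm) (measurable_coarsen Gm).

Definition coarse : probability (g_sigma_algebraType G) R :=
  distribution P (coarsen_rv Gm).

Lemma ge0_integral_coarse (f : g_sigma_algebraType G -> \bar R) :
  measurable_fun setT f -> (forall y, 0 <= f y) ->
  \int[coarse]_y f y = \int[P]_y f y.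
Proof. by move=> mf f0; rewrite ge0_integral_distribution. Qed.

Lemma integral_coarse (f : g_sigma_algebraType G -> \bar R) :
  measurable_fun setT f -> P.-integrable setT (f : T -> _) ->
  \int[coarse]_y f y = \int[P]_y f y.
Proof. by move=> mf f0; rewrite integral_distribution. Qed.

End Coarse.

Section Decouple.
Variables (G1 G2 : set (set T)).
Hypotheses (m1 : G1 `<=` measurable) (I1 : setI_closed G1) (T1 : G1 setT)
  (m2 : G2 `<=` measurable) (I2 : setI_closed G2) (T2 : G2 setT).
Hypothesis ind : forall A B, G1 A -> G2 B -> P (A `&` B) = P A * P B.

(** Independence says that the diagonal map from [T] to the product of the two coarse spaces has the
    product measure as its law; Tonelli's theorem then gives the iterated integral. *)
Lemma decouple (f : g_sigma_algebraType G1 * g_sigma_algebraType G2 -> \bar R) :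
  measurable_fun setT f -> (forall z, 0 <= f z) ->
  \int[P]_w f (w, w) = \int[coarse m1]_x \int[coarse m2]_y f (x, y).
Proof.
move=> mf f0.
rewrite -fubini_tonelli1 //.
pose phi (w : T) := (coarsen_rv m1 w, coarsen_rv m2 w).
have mphi : measurable_fun setT phi.
  by apply: measurable_fun_pair; exact: measurable_coarsen.
have -> : \int[P]_w f (w, w) = \int[pushforward P phi]_z f z.
  by rewrite (ge0_integral_pushforward mphi).
apply: eq_measure_integral => X mX _.
pose phi_mixin := isMeasurableFun.Build _ _ _ _ _ mphi.
pose phi_pack : {mfun T >-> _} := HB.pack phi phi_mixin.
transitivity (distribution P phi_pack X) => //.
have := @product_measure_unique _ _ _ _ _ (coarse m1) (coarse m2)
  (distribution P phi_pack) _ X mX.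
move=> h; apply/esym; apply: h => A B mA mB.
exact: (indep_sigma m1 I1 T1 m2 I2 T2 ind mA mB).
Qed.

End Decouple.
End Decoupling.

(** * Replacing the random summands one at a time *)

Section Iterate.
Context (R : realType).
Local Notation C := R[i].
Local Notation re := (@complex.Re R).
Local Notation im := (@complex.Im R).

Definition mx_gen m n : set (set 'M[C]_(m, n)) :=
  [set A | exists a b, exists2 B : set R, measurable B &
     A = (fun M : 'M[C]_(m, n) => re (M a b)) @^-1` B \/
     A = (fun M : 'M[C]_(m, n) => im (M a b)) @^-1` B].

Lemma mxmeas_comp d1 d2 (T1 : measurableType d1) (T2 : measurableType d2)
    m n (X : T2 -> 'M[C]_(m, n)) (g : T1 -> T2) :
  mxmeas X -> measurable_fun setT g -> mxmeas (fun w => X (g w)).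
Proof.
by move=> mX mg i j; have [m1 m2] := mX i j; 
  split; [exact: (measurableT_comp m1)|exact: (measurableT_comp m2)].
Qed.

Context (d : measure_display) (T : measurableType d) (P : probability T R).

Definition mxindep n N (X : 'I_n -> T -> 'M[C]_N) : Prop :=
  forall B : 'I_n -> set 'M[C]_N, (forall i, <<s @mx_gen N N >> (B i)) ->
    P (\bigcap_(i in [set: 'I_n]) (X i @^-1` B i)) = (\prod_(i < n) P (X i @^-1` B i))%E.

Lemma mxmeas_preimage m n (X : T -> 'M[C]_(m, n)) B : mxmeas X ->
  <<s @mx_gen m n >> B -> measurable (X @^-1` B).
Proof.
move=> mX; apply: (@smallest_sub _ _ _ [set B | measurable (X @^-1` B)]); last first.
  move=> A [a [b [E mE [->|->]]]] /=; have [m1 m2] := mX a b.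
    by rewrite -comp_preimage -[X in measurable X]setTI; exact: m1.
  by rewrite -comp_preimage -[X in measurable X]setTI; exact: m2.
split => /=.
- by rewrite preimage_set0.
- by move=> A mA; rewrite setTD preimage_setC; exact: measurableC.
- by move=> A mA; rewrite preimage_bigcup; apply: bigcup_measurable => k _; exact: mA.
Qed.

Section Sum.
Variables (n N : nat) (X : 'I_n -> T -> 'M[C]_N) (t : R).
Hypotheses (hX : forall i w, ctrmx (X i w) = X i w)
  (X01 : forall i w j, 0 <= eigval (X i w) j <= 1) (mX : forall i, mxmeas (X i))
  (indX : mxindep X).

Definition log_mgf i := hermfun (@ln R) (mgf_mx P (X i) t).

Let L := log_mgf.
Let hL i : ctrmx (L i) = L i. Proof. exact: hermfun_herm. Qed.

(** Hybrid sums: in [S k] the first [k] summands are random and the others are already replaced by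
    their deterministic bounds. [S n] is the random sum and [S 0] is constant. *)
Let term k (i : 'I_n) w := if (i < k)%N then t%:C%C *: X i w else L i.
Let S k w := \sum_i term k i w.

Let hterm k i w : ctrmx (term k i w) = term k i w.
Proof. by rewrite /term; case: ifP => _; rewrite ?ctrmxZ ?hX ?hL. Qed.

Section Peel.
Variable i0 : 'I_n.

(** Events that leave coordinate [i0] unconstrained. They are closed under intersection and make
    every other [X i] measurable. *)
Let G1 : set (set T) := [set A | exists B : 'I_n -> set 'M[C]_N,
  [/\ forall i, <<s @mx_gen N N >> (B i), B i0 = setT &
      A = \bigcap_(i in [set: 'I_n]) (X i @^-1` B i)]].
Let G2 : set (set T) := [set A | exists2 B : set 'M[C]_N,
  <<s @mx_gen N N >> B & A = X i0 @^-1` B].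

Let sT : <<s @mx_gen N N >> setT.
Proof. by case: (sigma_algebra_dynkin (smallest_sigma_algebra setT (@mx_gen N N))). Qed.

Let sI A B : <<s @mx_gen N N >> A -> <<s @mx_gen N N >> B -> <<s @mx_gen N N >> (A `&` B).
Proof.
have /sigma_algebraP := smallest_sigma_algebra setT (@mx_gen N N).
by case=> // _ _ _; exact.
Qed.

Let mcap (B : 'I_n -> set 'M[C]_N) : (forall i, <<s @mx_gen N N >> (B i)) ->
  measurable (\bigcap_(i in [set: 'I_n]) (X i @^-1` B i)).
Proof.
move=> mB; apply: fin_bigcap_measurable => // i _.
exact: mxmeas_preimage.
Qed.

Let m1 : G1 `<=` measurable.
Proof. by move=> A [B [mB _ ->]]; exact: mcap. Qed.

Let m2 : G2 `<=` measurable.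
Proof. by move=> A [B mB ->]; exact: mxmeas_preimage. Qed.

Let I1 : setI_closed G1.
Proof.
move=> A A' [B [mB B0 ->]] [B' [mB' B0' ->]]; exists (fun i => B i `&` B' i); split.
- by move=> i; exact: sI.
- by rewrite B0 B0' setIT.
- by rewrite -bigcapI; apply: eq_bigcapr => i _; rewrite preimage_setI.
Qed.

Let I2 : setI_closed G2.
Proof.
move=> A A' [B mB ->] [B' mB' ->]; exists (B `&` B'); first exact: sI.
by rewrite preimage_setI.
Qed.

Let T1 : G1 setT.
Proof.
exists (fun=> setT); split => //.
by apply/esym; rewrite -subTset => w _ i _.
Qed.

Let T2 : G2 setT.
Proof. by exists setT. Qed.

Let ind A B : G1 A -> G2 B -> P (A `&` B) = (P A * P B)%E.
Proof.
move=> [F [mF F0 ->]] [E mE ->].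
(* The event from [G1] leaves slot [i0] free, so [E] fits there and joint independence applies to
   the combined family. *)
pose F' i := if i == i0 then E else F i.
have mF' i : <<s @mx_gen N N >> (F' i) by rewrite /F'; case: ifP.
have -> : \bigcap_(i in [set: 'I_n]) (X i @^-1` F i) `&` X i0 @^-1` E =
   \bigcap_(i in [set: 'I_n]) (X i @^-1` F' i).
  apply/seteqP; split => w /=.
    move=> [h1 h2] i _; rewrite /F' /preimage /=; case: eqP => [->|_] //.
    exact: (h1 i).
  move=> h; split.
    move=> i _; have := h i Logic.I; rewrite /F' /preimage /=; case: eqP => [->|//] _.
    by rewrite F0.
  by have := h i0 Logic.I; rewrite /F' eqxx.
rewrite !indX // (bigD1 i0) //= /F' eqxx [in RHS](bigD1 i0) //= F0 preimage_setT.
rewrite probability_setT mul1e muleC; congr (_ * _)%E.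
by apply: eq_bigr => i /negbTE ->.
Qed.

Let mX1 i : i != i0 -> @mxmeas R _ (g_sigma_algebraType G1) N N (X i).
Proof.
move=> ii0 a b; split=> _ B mB; rewrite setTI; apply: sub_sigma_algebra.
  exists (fun j => if j == i then (fun M : 'M[C]_N => re (M a b)) @^-1` B else setT).
  split.
  - move=> j; case: ifP => _ //; apply: sub_sigma_algebra.
    by exists a, b; exists B => //; left.
  - by rewrite eq_sym (negbTE ii0).
  - apply/seteqP; split => w /=.
      by move=> h j _; rewrite /preimage /=; case: eqP => // ->.
    by move=> /(_ i Logic.I); rewrite /preimage /= eqxx.
exists (fun j => if j == i then (fun M : 'M[C]_N => im (M a b)) @^-1` B else setT).
split.
- move=> j; case: ifP => _ //; apply: sub_sigma_algebra.
  by exists a, b; exists B => //; right.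
- by rewrite eq_sym (negbTE ii0).
- apply/seteqP; split => w /=.
    by move=> h j _; rewrite /preimage /=; case: eqP => // ->.
  by move=> /(_ i Logic.I); rewrite /preimage /= eqxx.
Qed.

Let mX2 : @mxmeas R _ (g_sigma_algebraType G2) N N (X i0).
Proof.
move=> a b; split=> _ B mB; rewrite setTI; apply: sub_sigma_algebra.
  exists ((fun M : 'M[C]_N => re (M a b)) @^-1` B) => //.
  by apply: sub_sigma_algebra; exists a, b; exists B => //; left.
exists ((fun M : 'M[C]_N => im (M a b)) @^-1` B) => //.
by apply: sub_sigma_algebra; exists a, b; exists B => //; right.
Qed.

Let H k w := \sum_(i < n | i != i0) term k i w.

Let hH k w : ctrmx (H k w) = H k w.
Proof.
rewrite /H -big_filter ctrmx_sum; apply: eq_bigr => i _.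
exact: hterm.
Qed.

Let mH k : @mxmeas R _ (g_sigma_algebraType G1) N N (H k).
Proof.
have -> : H k = fun w => \sum_(i < n) if i != i0 then term k i w else 0.
  by apply/funext => w; rewrite /H big_mkcond.
apply: mxmeas_sum => i; case: (boolP (i != i0)) => [ii0|_]; last exact: mxmeas_cst.
rewrite /term; case: (i < k)%N; last exact: mxmeas_cst.
by apply: mxmeasZ; exact: mX1.
Qed.

Let bXr a b : bmeas (fun w => re (X i0 w a b)) /\ bmeas (fun w => im (X i0 w a b)).
Proof.
exact: (mxbmeas01 (hX i0) (X01 i0) (mX i0)).
Qed.

(** [lieb_step] will be applied on the coarse space of [G2], where the mean of [X i0] is a priori
    another integral. *)
Let mgf2 : mgf_mx (coarse P m2) (X i0) t = mgf_mx P (X i0) t.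
Proof.
rewrite /mgf_mx; congr (_ + _ *: _); apply/matrixP=> a b; rewrite !mxE.
have [r1 r2] := mX2 a b; have [b1 b2] := bXr a b.
rewrite !ExE /Rintegral; congr (fine _ +i* fine _)%C.
  rewrite integral_coarse //; first exact/measurable_EFinP.
  exact: (bmeas_int P b1).
rewrite integral_coarse //; first exact/measurable_EFinP.
exact: (bmeas_int P b2).
Qed.

(** After decoupling, the inner integral has the other summands frozen: a fixed Hermitian [H k x]
    plus one random matrix, the situation of [lieb_step]. *)
Lemma peel_step k :
  (\int[P]_w (trexp (H k w + t%:C%C *: X i0 w))%:E <=
   \int[P]_w (trexp (H k w + L i0))%:E)%E.
Proof.
pose f (z : g_sigma_algebraType G1 * g_sigma_algebraType G2) : \bar R :=
  (trexp (H k z.1 + t%:C%C *: X i0 z.2))%:E.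
have h1 z1 z2 : ctrmx (H k z1 + t%:C%C *: X i0 z2) = H k z1 + t%:C%C *: X i0 z2.
  by rewrite ctrmxD hH ctrmxZ hX.
have mf : measurable_fun setT f.
  apply/measurable_EFinP; apply: measurable_trexp => // .
  apply: mxmeasD; first exact: (mxmeas_comp (mH k) measurable_fst).
  by apply: mxmeasZ; exact: (mxmeas_comp mX2 measurable_snd).
have f0 z : (0 <= f z)%E by rewrite lee_fin trexp_ge0.
have h2 w : ctrmx (H k w + L i0) = H k w + L i0 by rewrite ctrmxD hH hL.
have mg : measurable_fun (setT : set (g_sigma_algebraType G1))
    (fun w => (trexp (H k w + L i0))%:E).
  apply/measurable_EFinP; apply: measurable_trexp => //.
  by apply: mxmeasD; [exact: mH|exact: mxmeas_cst].
rewrite -(ge0_integral_coarse P m1 mg) => [|y]; last by rewrite lee_fin trexp_ge0.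
have -> : (\int[P]_w (trexp (H k w + t%:C%C *: X i0 w))%:E = \int[P]_w f (w, w))%E by [].
rewrite (decouple m1 I1 T1 m2 I2 T2 ind mf f0).
apply: ge0_le_integral => //.
- by move=> x _; apply: integral_ge0 => y _.
- exact: (measurable_fun_fubini_tonelli_F (m2 := coarse P m2) f mf f0).
- move=> x _; rewrite /f /=.
have hb : bmeas (fun y : g_sigma_algebraType G2 => trexp (H k x + t%:C%C *: X i0 y)).
  exact: (@bmeas_trexp R _ (g_sigma_algebraType G2) N (H k x) (X i0) t
    (hH k x) (hX i0) (X01 i0) mX2).
have := @lieb_step R _ (g_sigma_algebraType G2) (coarse P m2) N (H k x) (X i0) t
    (hH k x) (hX i0) (X01 i0) mX2.
rewrite mgf2 -lee_fin; apply: le_trans.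
rewrite ExE /Rintegral fineK //.
by apply: integrable_fin_num => //; exact: bmeas_int.
Qed.

End Peel.

Lemma trexp_sum_le :
  (\int[P]_w (trexp (t%:C%C *: \sum_i X i w))%:E <= (trexp (\sum_i L i))%:E)%E.
Proof.
have key k : (k <= n)%N ->
  (\int[P]_w (trexp (S k w))%:E <= (trexp (\sum_i L i))%:E)%E.
  elim: k => [_|k IH kn].
    under eq_integral => w _.
      rewrite (_ : S 0 w = \sum_i L i); last by apply: eq_bigr.
      over.
    rewrite integral_cst // [X in (_ * X)%E](_ : _ = 1%E) ?mule1 //.
    exact: (@probability_setT _ _ _ P).
  apply: le_trans (IH (ltnW kn)).
  have e1 w : S k.+1 w = \sum_(i < n | i != Ordinal kn) term k i w + t%:C%C *: X (Ordinal kn) w.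
    rewrite /S (bigD1 (Ordinal kn)) //= addrC {2}/term ltnSn; congr (_ + _).
    apply: eq_bigr => i ik; rewrite /term ltnS leq_eqVlt.
    by rewrite -[(i : nat) == k]/(i == Ordinal kn) (negbTE ik).
  have e2 w : S k w = \sum_(i < n | i != Ordinal kn) term k i w + L (Ordinal kn).
    by rewrite /S (bigD1 (Ordinal kn)) //= addrC {2}/term ltnn.
  under eq_integral do rewrite e1.
  under [leRHS]eq_integral do rewrite e2.
  exact: peel_step.
apply: le_trans (key n (leqnn n)); rewrite le_eqVlt; apply/orP; left; apply/eqP.
apply: eq_integral => w _; congr (trexp _)%:E; rewrite scaler_sumr.
by apply: eq_bigr => i _; rewrite /term ltn_ord.
Qed.

End Sum.
End Iterate.

(** * Tail bounds for extreme eigenvalues *)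

Section MatrixChernoff.
Context (R : realType).
Local Notation C := R[i].
Local Notation re := (@complex.Re R).
Local Notation im := (@complex.Im R).

Lemma sumr_const_ord (n : nat) (x : R) : \sum_(i < n) x = n%:R * x.
Proof. by rewrite sumr_const card_ord mulr_natl. Qed.

(** [teig], [lambda_max] and [lambda_min] of a tensor are convertible to these notions at its
    [bcirc], so the tail bounds can be proved for matrices of any positive size. *)
Definition mxeig N (H : 'M[C]_N) : set R := [set x : R | eigenvalue H (x%:C)%C].
Definition lmax N (H : 'M[C]_N) : R := sup (mxeig H).
Definition lmin N (H : 'M[C]_N) : R := inf (mxeig H).

Lemma mxeig_eigval N (H : 'M[C]_N) : ctrmx H = H -> mxeig H = range (eigval H).
Proof.
move=> hH; have hu := eigbasis_uni hH; have hu' := unimxr hu.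
have HU : H *m eigbasis H = eigbasis H *m rdiag (eigval H).
  by rewrite -{1}(spectral_decomp hH) /unidiag -mulmxA hu mulmx1.
apply/seteqP; split => x /=.
  move/eigenvalueP => [v vH v0].
  have w0 : v *m eigbasis H != 0.
    by apply: contra_neq v0 => e; rewrite -[v]mulmx1 -hu' mulmxA e mul0mx.
  have [j wj] : exists j, (v *m eigbasis H) 0 j != 0.
    apply/existsP; apply: contraNT w0; rewrite negb_exists => /forallP h.
    by apply/eqP/rowP => j; rewrite [RHS]mxE; apply/eqP; have := h j; rewrite negbK.
  exists j => //; have := congr1 (fun M : 'rV_N => (M *m eigbasis H) 0 j) vH.
  rewrite -mulmxA HU mulmxA mul_mxrdiag -scalemxAl [in RHS]mxE mulrC => e.
  by move: (mulIf wj e) => /complexI.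
(* [eigenvalue] is about row vectors, so the eigenvectors are rows of the conjugate transpose of the
   eigenbasis. *)
move=> [j _ <-]; apply/eigenvalueP; exists (row j (ctrmx (eigbasis H))).
  have HU' : ctrmx (eigbasis H) *m H = rdiag (eigval H) *m ctrmx (eigbasis H).
    by rewrite -{2}(spectral_decomp hH) /unidiag !mulmxA hu mul1mx.
  rewrite -row_mul HU'; apply/rowP => k.
  by rewrite [LHS]mxE mul_rdiag [RHS]mxE [in RHS]mxE.
apply/eqP => e; have := congr1 (fun M : 'rV_N => (M *m eigbasis H) 0 j) e.
rewrite -row_mul hu mul0mx !mxE eqxx => /eqP.
by rewrite oner_eq0.
Qed.

Lemma lmaxP N (H : 'M[C]_N) : (0 < N)%N -> ctrmx H = H ->
  (forall i, eigval H i <= lmax H) /\ exists i, lmax H = eigval H i.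
Proof.
case: N H => // N H _ hH; rewrite /lmax mxeig_eigval //.
case: (arg_maxP (eigval H) (erefl : predT (ord0 : 'I_N.+1))) => i _ hi.
have -> : sup (range (eigval H)) = eigval H i.
  apply/eqP; rewrite eq_le; apply/andP; split.
    by apply: ge_sup; [exists (eigval H i), i|move=> _ [j _ <-]; exact: hi].
  apply: ub_le_sup; last by exists i.
  by exists (eigval H i) => _ [j _ <-]; exact: hi.
by split; [move=> j; exact: hi|exists i].
Qed.

Lemma mxeigN N (H : 'M[C]_N) : mxeig (- H) = [set - x | x in mxeig H].
Proof.
have key (M : 'M[C]_N) x : mxeig M x -> mxeig (- M) (- x).
  move=> /eigenvalueP[v vM v0]; apply/eigenvalueP; exists v => //.
  by rewrite mulmxN vM rmorphN scaleNr.
apply/seteqP; split => x /=.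
  by move=> /key; rewrite opprK => h; exists (- x); rewrite ?opprK.
by move=> [y /key h <-].
Qed.

Lemma lmin_lmax N (H : 'M[C]_N) : lmin H = - lmax (- H).
Proof. by rewrite /lmin /inf /lmax mxeigN. Qed.

Lemma ctrmxN m n (H : 'M[C]_(m, n)) : ctrmx (- H) = - ctrmx H.
Proof. by apply/matrixP=> i j; rewrite !mxE rmorphN. Qed.

Lemma qfN N (H : 'M[C]_N) v : qf (- H) v = - qf H v.
Proof. by rewrite /qf mulmxN mulNmx mxE reN. Qed.

Lemma qf_le_lmax N (H : 'M[C]_N) v : (0 < N)%N -> ctrmx H = H ->
  qf H v <= lmax H * qf 1%:M v.
Proof.
move=> N0 hH; have [h _] := lmaxP N0 hH.
by rewrite -{1}(spectral_decomp hH); apply: qf_le_unidiag => //; exact: eigbasis_uni.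
Qed.

Lemma lmin_le_qf N (H : 'M[C]_N) v : (0 < N)%N -> ctrmx H = H ->
  lmin H * qf 1%:M v <= qf H v.
Proof.
move=> N0 hH; rewrite lmin_lmax mulNr lerNl -qfN.
by apply: qf_le_lmax => //; rewrite ctrmxN hH.
Qed.

Lemma lmax_attained N (H : 'M[C]_N) : (0 < N)%N -> ctrmx H = H ->
  exists2 v, qf 1%:M v = 1 & qf H v = lmax H.
Proof.
move=> N0 hH; have [_ [i ->]] := lmaxP N0 hH.
exists (col i (eigbasis H)); first by rewrite qf1_col //; exact: eigbasis_uni.
by rewrite -{1}(spectral_decomp hH) qf_unidiag_col //; exact: eigbasis_uni.
Qed.

Lemma lmin_attained N (H : 'M[C]_N) : (0 < N)%N -> ctrmx H = H ->
  exists2 v, qf 1%:M v = 1 & qf H v = lmin H.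
Proof.
move=> N0 hH; have hN : ctrmx (- H) = - H by rewrite ctrmxN hH.
have [v v1 vH] := lmax_attained N0 hN; exists v => //.
by rewrite lmin_lmax -vH qfN opprK.
Qed.

(** Stated for a unit vector so as to serve both tails: for [t <= 0], a vector attaining the
    smallest eigenvalue of the sum maximises the form of [t] times the sum. *)
Lemma expR_qf_le_trexp N (H : 'M[C]_N) v x : (0 < N)%N -> ctrmx H = H ->
  qf 1%:M v = 1 -> x <= qf H v -> expR x <= trexp H.
Proof.
move=> N0 hH v1 xv; have [_ [i hi]] := lmaxP N0 hH.
have : x <= eigval H i.
  by rewrite -hi (le_trans xv) // (le_trans (qf_le_lmax v N0 hH)) // v1 mulr1.
move=> xi; rewrite trexpE // (bigD1 i) //=.
apply: (@le_trans _ _ (expR (eigval H i))); first by rewrite ler_expR.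
by rewrite lerDl; apply: sumr_ge0 => j _; exact: expR_ge0.
Qed.

Lemma qf_le2 N (U : 'M[C]_N) a b v : (forall i, a i <= b i) ->
  qf (unidiag U a) v <= qf (unidiag U b) v.
Proof.
by move=> ab; rewrite !qf_unidiag; apply: ler_sum => i _; rewrite ler_wpM2r ?sqnorm_ge0.
Qed.

(* ln x <= ln l + x / l - 1, applied to the eigenvalues. *)
Lemma qf_ln_le N (M : 'M[C]_N) (l : R) v : ctrmx M = M -> (forall i, 0 < eigval M i) ->
  0 < l -> qf (hermfun (@ln R) M) v <= (ln l - 1) * qf 1%:M v + l^-1 * qf M v.
Proof.
move=> hM M0 l0; have hu := eigbasis_uni hM.
rewrite -{2}(spectral_decomp hM) -(unidiag1 hu) -!qfZ !unidiagZ -qfD unidiagD.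
apply: qf_le2 => i /=; rewrite mulr1.
have : ln (eigval M i / l) <= eigval M i / l - 1 by apply: ln_le_sub1; rewrite divr_gt0.
rewrite lnM ?posrE ?invr_gt0 // lnV ?posrE // mulrC; lra.
Qed.

Section Measurability.
Context (d : measure_display) (T : measurableType d).

(** [lmax] is the pointwise limit of [ln (Tr exp (k X)) / k], which exceeds it by at most
    [ln N / k]. *)
Lemma measurable_lmax N (X : T -> 'M[C]_N) : (0 < N)%N ->
  (forall w, ctrmx (X w) = X w) -> mxmeas X ->
  measurable_fun setT (fun w => lmax (X w)).
Proof.
move=> N0 hX mX.
pose g (k : nat) w : R :=
  k.+1%:R^-1 * ln (rtr (hermfun (fun y => expR (k.+1%:R * y)) (X w))).
apply: (@measurable_fun_cvg _ _ _ _ g) => [k|w _].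
  apply: measurable_funM => //; apply: measurableT_comp => //.
  by apply: measurable_rtr; exact: mxmeas_exp.
have [hi [i0 hi0]] := lmaxP N0 (hX w).
apply: (@squeeze_cvgr _ _ _ _ (fun=> lmax (X w)) (fun k => lmax (X w) + ln N%:R * harmonic k)).
- near=> k; rewrite /g rtr_unidiag; last exact: eigbasis_uni.
  have k0 : 0 < k.+1%:R :> R by rewrite ltr0n.
  have e0 : expR (k.+1%:R * lmax (X w)) <= \sum_i expR (k.+1%:R * eigval (X w) i).
    rewrite (bigD1 i0) //= hi0 lerDl.
    by apply: sumr_ge0 => j _; exact: expR_ge0.
  have e1 : \sum_i expR (k.+1%:R * eigval (X w) i) <= N%:R * expR (k.+1%:R * lmax (X w)).
    rewrite -sumr_const_ord.
    by apply: ler_sum => j _; rewrite ler_expR ler_pM2l.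
  have s0 : 0 < \sum_i expR (k.+1%:R * eigval (X w) i).
    by apply: lt_le_trans e0; exact: expR_gt0.
  apply/andP; split.
    rewrite mulrC ler_pdivlMr // mulrC -[leLHS]expRK ler_ln ?posrE ?expR_gt0 //.
  rewrite mulrC ler_pdivrMr // mulrDl /= /harmonic -mulrA mulVf ?gt_eqF // mulr1.
  have -> : lmax (X w) * k.+1%:R + ln N%:R = ln (N%:R * expR (k.+1%:R * lmax (X w))).
    by rewrite lnM ?posrE ?expR_gt0 ?ltr0n // expRK addrC mulrC.
  by rewrite ler_ln // posrE mulr_gt0 ?expR_gt0 ?ltr0n.
- exact: cvg_cst.
- rewrite -[X in _ --> X]addr0 -[X in _ --> _ + X](mulr0 (ln N%:R)).
  apply: cvgD; first exact: cvg_cst.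
  by apply: cvgMr; exact: cvg_harmonic.
Unshelve. all: by end_near.
Qed.

Lemma mxmeasN m n (X : T -> 'M[C]_(m, n)) : mxmeas X -> mxmeas (fun w => - X w).
Proof.
move=> mX; have -> : (fun w => - X w) = (fun w => (-1)%:C%C *: X w).
  by apply/funext => w; rewrite rmorphN1 scaleN1r.
exact: mxmeasZ.
Qed.

Lemma measurable_lmax_ge N (X : T -> 'M[C]_N) x : (0 < N)%N ->
  (forall w, ctrmx (X w) = X w) -> mxmeas X ->
  measurable [set w | x <= lmax (X w)].
Proof.
move=> N0 hX mX; rewrite (_ : [set w | _] = setT `&` (fun w => lmax (X w)) @^-1` `[x, +oo[%classic).
  by apply: measurable_lmax => //; exact: measurable_itv.
by apply/seteqP; split => w /=; rewrite in_itv /= andbT => // -[].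
Qed.

Lemma measurable_lmin_le N (X : T -> 'M[C]_N) x : (0 < N)%N ->
  (forall w, ctrmx (X w) = X w) -> mxmeas X ->
  measurable [set w | lmin (X w) <= x].
Proof.
move=> N0 hX mX; rewrite (_ : [set w | _] = [set w | - x <= lmax (- X w)]).
  by apply: measurable_lmax_ge => // [w|]; [rewrite ctrmxN hX|exact: mxmeasN].
by apply/seteqP; split => w /=; rewrite lmin_lmax lerNl.
Qed.

End Measurability.

Context (d : measure_display) (T : measurableType d) (P : probability T R).
Variables (n N : nat) (X : 'I_n -> T -> 'M[C]_N).
Hypotheses (n0 : (0 < n)%N) (N0 : (0 < N)%N) (hX : forall i w, ctrmx (X i w) = X i w)
  (X01 : forall i w j, 0 <= eigval (X i w) j <= 1) (mX : forall i, mxmeas (X i))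
  (indX : mxindep P X).

(** One tangent line of [ln], at [l], serves all summands, so the bound is linear in their means and
    only the average matters. The constants add up to [n ln l] because [(n + n (l - 1)) / l = n]. *)
Lemma trexp_log_mgf_le (t l : R) : 0 < l ->
  (forall v, (expR t - 1) * \sum_i qf (Emx P (X i)) v <= n%:R * (l - 1) * qf 1%:M v) ->
  trexp (\sum_i log_mgf P X t i) <= N%:R * l ^+ n.
Proof.
move=> l0 hle; set S := \sum_i _.
have hS : ctrmx S = S by rewrite ctrmx_sum; apply: eq_bigr => i _; exact: hermfun_herm.
rewrite trexpE // -sumr_const_ord.
apply: ler_sum => j _; have -> : l ^+ n = expR (n%:R * ln l).
  by rewrite expRM_natl lnK.
rewrite ler_expR; apply: (unidiag_le_qf (eigbasis_uni hS)) => v; rewrite spectral_decomp //.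
rewrite /S qf_sum.
apply: (@le_trans _ _ (\sum_(i < n) ((ln l - 1) * qf 1%:M v + l^-1 * qf (mgf_mx P (X i) t) v))).
  apply: ler_sum => i _; apply: qf_ln_le => //.
    exact: mgf_mx_herm.
  by move=> k; exact: mgf_mx_gt0.
rewrite big_split /= sumr_const_ord -mulr_sumr.
have -> : \sum_i qf (mgf_mx P (X i) t) v =
    n%:R * qf 1%:M v + (expR t - 1) * \sum_i qf (Emx P (X i)) v.
  under eq_bigr do rewrite qf_mgf_mx.
  by rewrite big_split /= sumr_const_ord -mulr_sumr.
have h : l^-1 * ((expR t - 1) * \sum_i qf (Emx P (X i)) v) <=
   l^-1 * (n%:R * (l - 1) * qf 1%:M v) by rewrite ler_wpM2l ?invr_ge0 // ltW.
rewrite mulrDr.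
have e : l^-1 * (n%:R * (l - 1) * qf 1%:M v) =
   n%:R * qf 1%:M v - l^-1 * (n%:R * qf 1%:M v) by field; rewrite gt_eqF.
rewrite e in h; lra.
Qed.

Lemma trexp_markov (t l s : R) (E : set T) : measurable E -> 0 < l ->
  (forall v, (expR t - 1) * \sum_i qf (Emx P (X i)) v <= n%:R * (l - 1) * qf 1%:M v) ->
  (forall w, E w -> expR s <= trexp (t%:C%C *: \sum_i X i w)) ->
  (P E <= @EFin R (N%:R * (expR (- s) * l ^+ n))%R)%E.
Proof.
move=> mE l0 hq hE.
have hS w : ctrmx (t%:C%C *: \sum_i X i w) = t%:C%C *: \sum_i X i w.
  by rewrite ctrmxZ ctrmx_sum; congr (_ *: _); apply: eq_bigr.
have mf : measurable_fun setT (fun w => (trexp (t%:C%C *: \sum_i X i w))%:E).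
  apply/measurable_EFinP; apply: measurable_trexp => //.
  by apply: mxmeasZ; exact: mxmeas_sum.
have h1 : ((expR s)%:E * P E <= \int[P]_w (trexp (t%:C%C *: \sum_i X i w))%:E)%E.
  apply: (@le_trans _ _ (\int[P]_(w in E) (trexp (t%:C%C *: \sum_i X i w))%:E)%E).
    rewrite -integral_cst //; apply: ge0_le_integral => //.
    - by move=> w _; rewrite lee_fin expR_ge0.
    - by apply: (measurable_funS measurableT).
  apply: (ge0_subset_integral P mE measurableT mf) => // w _.
  by rewrite lee_fin trexp_ge0.
have h2 : ((expR s)%:E * P E <= @EFin R (N%:R * l ^+ n)%R)%E.
  apply: (le_trans h1); apply: (le_trans (trexp_sum_le t hX X01 mX indX)).
  by rewrite lee_fin; exact: trexp_log_mgf_le.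
have -> : @EFin R (N%:R * (expR (- s) * l ^+ n))%R = ((expR s)^-1%:E * @EFin R (N%:R * l ^+ n)%R)%E.
  by rewrite -EFinM expRN mulrCA.
have -> : P E = ((expR s)^-1%:E * ((expR s)%:E * P E))%E.
  by rewrite muleA -EFinM mulVf ?mul1e // gt_eqF ?expR_gt0.
have e0 : (0 <= (expR s)^-1%:E)%E by rewrite lee_fin invr_ge0 expR_ge0.
exact: (lee_wpmul2l e0 h2).
Qed.

Let Eb : 'M[C]_N := n%:R^-1 *: \sum_i Emx P (X i).
Let Xb w : 'M[C]_N := n%:R^-1 *: \sum_i X i w.

Let nC : (n%:R^-1 : C) = (n%:R^-1 : R)%:C%C.
Proof. by rewrite fmorphV rmorph_nat. Qed.

Let nR : 0 < n%:R :> R. Proof. by rewrite ltr0n. Qed.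

Lemma mean_herm (Y : 'I_n -> 'M[C]_N) : (forall i, ctrmx (Y i) = Y i) ->
  ctrmx (n%:R^-1 *: \sum_i Y i) = n%:R^-1 *: \sum_i Y i.
Proof.
by move=> h; rewrite nC ctrmxZ ctrmx_sum; congr (_ *: _); apply: eq_bigr.
Qed.

Lemma qf_mean (Y : 'I_n -> 'M[C]_N) v :
  \sum_i qf (Y i) v = n%:R * qf (n%:R^-1 *: \sum_i Y i) v.
Proof. by rewrite nC qfZ qf_sum mulrA divff ?mul1r // gt_eqF. Qed.

Lemma Emx_mean_herm : ctrmx Eb = Eb.
Proof.
apply: mean_herm => i; apply: Emx_herm => //.
exact: (mxbmeas01 (hX i) (X01 i) (mX i)).
Qed.

Lemma Emx_mean_bounds : 0 <= lmin Eb /\ lmax Eb <= 1.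
Proof.
have h v : 0 <= qf Eb v <= qf 1%:M v.
  have := qf_mean (fun i => Emx P (X i)) v; rewrite -/Eb => e.
  apply/andP; split.
    rewrite -(pmulr_rge0 _ nR) -e.
    by apply: sumr_ge0 => i _; case/andP: (qf_Emx01 P (hX i) (X01 i) (mX i) v).
  rewrite -(ler_pM2l nR) -e -sumr_const_ord; apply: ler_sum => i _.
  by case/andP: (qf_Emx01 P (hX i) (X01 i) (mX i) v).
have [v v1 <-] := lmax_attained N0 Emx_mean_herm.
have [u u1 <-] := lmin_attained N0 Emx_mean_herm.
by split; [case/andP: (h u)|rewrite -v1; case/andP: (h v)].
Qed.

Lemma lmin_le_lmax : lmin Eb <= lmax Eb.
Proof.
have [v v1 <-] := lmax_attained N0 Emx_mean_herm.
by rewrite -[leLHS]mulr1 -v1 lmin_le_qf //; exact: Emx_mean_herm.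
Qed.

Lemma lmax_tail (t theta : R) : 0 <= t ->
  (P [set w | (theta <= lmax (Xb w))%R] <=
   @EFin R (N%:R * (expR (- (t * theta)) * (1 + (expR t - 1) * lmax Eb)) ^+ n)%R)%E.
Proof.
move=> t0; have c0 : 0 <= expR t - 1 by rewrite subr_ge0 -[leLHS]expR0 ler_expR.
have [m0 m1] := Emx_mean_bounds; have mm := lmin_le_lmax.
have l0 : 0 < 1 + (expR t - 1) * lmax Eb.
  by rewrite ltr_wpDr // mulr_ge0 // (le_trans m0).
have hXb w : ctrmx (Xb w) = Xb w by apply: mean_herm.
(* Splitting the power exposes the threshold [s = n t theta] of [trexp_markov], the sum being [n]
   times the mean. *)
rewrite exprMn -expRM_natl mulrN.
apply: (trexp_markov (t := t)) => //.
- apply: measurable_lmax_ge => //.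
  by rewrite /Xb; under eq_fun do rewrite nC; apply: mxmeasZ; exact: mxmeas_sum.
- move=> v; rewrite (addrC 1) addrK qf_mean -/Eb mulrCA -[leRHS]mulrA ler_pM2l // -[leRHS]mulrA.
  by rewrite ler_wpM2l // qf_le_lmax //; exact: Emx_mean_herm.
move=> w /= hw; have [v v1 vX] := lmax_attained N0 (hXb w).
apply: (@expR_qf_le_trexp _ _ v) => //.
  by rewrite ctrmxZ ctrmx_sum; congr (_ *: _); apply: eq_bigr.
rewrite qfZ qf_sum qf_mean -/(Xb w) vX (mulrCA t) ler_pM2l // ler_wpM2l //.
Qed.

(** For [t <= 0] the factor [expR t - 1] is nonpositive, so the lower bound [lmin Eb] on the form of
    the mean yields the upper bound that [trexp_markov] asks for. *)
Lemma lmin_tail (t theta : R) : t <= 0 ->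
  (P [set w | (lmin (Xb w) <= theta)%R] <=
   @EFin R (N%:R * (expR (- (t * theta)) * (1 + (expR t - 1) * lmin Eb)) ^+ n)%R)%E.
Proof.
move=> t0; have c0 : expR t - 1 <= 0 by rewrite subr_le0 -[leRHS]expR0 ler_expR.
have [m0 m1] := Emx_mean_bounds; have mm := lmin_le_lmax.
have l0 : 0 < 1 + (expR t - 1) * lmin Eb.
  by apply: chord_gt0; rewrite m0 (le_trans mm).
have hXb w : ctrmx (Xb w) = Xb w by apply: mean_herm.
rewrite exprMn -expRM_natl mulrN.
apply: (trexp_markov (t := t)) => //.
- apply: measurable_lmin_le => //.
  by rewrite /Xb; under eq_fun do rewrite nC; apply: mxmeasZ; exact: mxmeas_sum.
- move=> v; rewrite (addrC 1) addrK qf_mean -/Eb mulrCA -[leRHS]mulrA ler_pM2l // -[leRHS]mulrA.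
  by rewrite ler_wnM2l // lmin_le_qf //; exact: Emx_mean_herm.
move=> w /= hw; have [v v1 vX] := lmin_attained N0 (hXb w).
apply: (@expR_qf_le_trexp _ _ v) => //.
  by rewrite ctrmxZ ctrmx_sum; congr (_ *: _); apply: eq_bigr.
rewrite qfZ qf_sum qf_mean -/(Xb w) vX (mulrCA t) ler_pM2l // ler_wnM2l //.
Qed.

End MatrixChernoff.

(** * The optimal exponent and the binary divergence *)

Section Optimise.
Context (R : realType).

(** For the degenerate parameters at which the infimum over [t] is only approached as [t] tends to
    infinity. *)
Lemma geom_limit_le (q K a b s : R) n : 0 < s ->
  (forall k : nat, q <= K * (a + b * expR (- (k%:R * s))) ^+ n) -> q <= K * a ^+ n.
Proof.
move=> s0 h.
have z0 : expR (- (k%:R * s)) @[k --> \oo] --> (0 : R).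
  rewrite (_ : (fun k => _) = (fun k => expR (- s) ^+ k)); last first.
    by apply/funext => k; rewrite -mulrN expRM_natl.
  by apply: cvg_expr; rewrite ger0_norm ?expR_ge0 // -[ltRHS]expR0 ltr_expR oppr_lt0.
have f0 : K * (a + b * expR (- (k%:R * s))) ^+ n @[k --> \oo] --> K * a ^+ n.
  have g0 : a + b * expR (- (k%:R * s)) @[k --> \oo] --> a.
    have : a + b * expR (- (k%:R * s)) @[k --> \oo] --> a + b * 0.
      by apply: cvgD; [exact: cvg_cst|exact: cvgMr].
    by rewrite mulr0 addr0.
  by apply: cvgMr; apply: (continuous_cvg _ (@exprn_continuous _ n a)).
rewrite -(cvg_lim (@Rhausdorff R) f0).
by apply: limr_ge; [apply/cvg_ex; exists (K * a ^+ n)|apply: nearW].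
Qed.

Lemma bdiv_refl (c : R) : bdiv c c = 0%E.
Proof.
have x0 (x : R) : xlogxy x x = 0%E.
  by rewrite /xlogxy; case: eqVneq => // x0; rewrite divff // ln1 mulr0.
by rewrite /bdiv !x0 adde0.
Qed.

Lemma bdivC (c d : R) : bdiv (1 - c) (1 - d) = bdiv c d.
Proof. by rewrite /bdiv !subKr addeC. Qed.

Lemma chernoff_optimise (q K mu theta : R) n : (0 < n)%N -> 0 <= mu ->
  mu <= theta <= 1 ->
  (forall t, 0 <= t ->
     q <= K * (expR (- (t * theta)) * (1 + (expR t - 1) * mu)) ^+ n) ->
  (q%:E <= K%:E * expeR (- (n%:R%:E * bdiv theta mu)))%E.
Proof.
move=> n0 mu0 /andP[mt t1] h.
have eE (x : R) : (K%:E * expeR (- (n%:R%:E * x%:E)))%E = (K * expR (- (n%:R * x)))%:E.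
  by [].
have nR : (0 < n%:R%:E :> \bar R)%E by rewrite lte_fin ltr0n.
(* The divergence vanishes, and [t = 0] gives the trivial bound [K]. *)
have [e|ne] := eqVneq mu theta.
  rewrite -e bdiv_refl mule0 oppe0 /= expR0 mule1 lee_fin.
  by have := h 0 (lexx _); rewrite mul0r oppr0 expR0 subrr mul0r addr0 mulr1 expr1n mulr1.
have {}mt : mu < theta by rewrite lt_neqAle ne.
have th0 : 0 < theta by apply: le_lt_trans mt.
(* Here the divergence is [+oo] and the right-hand side is zero, reached as [t] tends to
   infinity. *)
have [m0|mn0] := eqVneq mu 0.
  have -> : bdiv theta mu = +oo%E.
    rewrite /bdiv m0 {1}/xlogxy gt_eqF // eqxx addye // /xlogxy subr0 oner_eq0.
    by case: ifP.
  rewrite gt0_muley //= mule0 lee_fin.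
  have := @geom_limit_le q K 0 1 theta n th0; rewrite expr0n gtn_eqF // mulr0; apply => k.
  by have := h k%:R (ler0n _ _); rewrite m0 mulr0 addr0 mulr1 add0r mul1r.
have {mn0} m0 : 0 < mu by rewrite lt0r mn0.
(* The bound is now [K * mu ^+ n], again the limit as [t] tends to infinity. *)
have [e|tn1] := eqVneq theta 1.
  have m1 : mu < 1 by rewrite -e.
  have -> : bdiv theta mu = (ln mu^-1)%:E.
    by rewrite /bdiv e subrr /xlogxy eqxx oner_eq0 gt_eqF // adde0 mul1r div1r.
  rewrite eE lee_fin -mulrN expRM_natl lnV ?posrE // opprK lnK ?posrE //.
  apply: (@geom_limit_le q K mu (1 - mu) 1 n) => // k.
  have := h k%:R (ler0n _ _); rewrite e mulr1.
  have -> // : expR (- k%:R) * (1 + (expR k%:R - 1) * mu) = mu + (1 - mu) * expR (- k%:R).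
  rewrite mulrDr mulr1 mulrA mulrBr mulr1 -expRD addNr expR0; ring.
have {tn1} t1 : theta < 1 by rewrite lt_neqAle tn1.
have m1 : mu < 1 by apply: lt_trans t1.
have t1' : 0 < 1 - theta by rewrite subr_gt0.
have m1' : 0 < 1 - mu by rewrite subr_gt0.
have lnd (x y : R) : 0 < x -> 0 < y -> ln (x / y) = ln x - ln y.
  by move=> x0 y0; rewrite lnM ?posrE ?invr_gt0 // lnV ?posrE.
have -> : bdiv theta mu = (theta * (ln theta - ln mu) +
    (1 - theta) * (ln (1 - theta) - ln (1 - mu)))%:E.
  by rewrite /bdiv /xlogxy !gt_eqF // !lnd.
rewrite eE lee_fin -mulrN expRM_natl.
(* [ln r] is the stationary point in [t] of [- t theta + ln (1 + (expR t - 1) mu)]; there the second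
   factor equals [(1 - mu) / (1 - theta)]. It is nonnegative because [mu < theta]. *)
set r := theta * (1 - mu) / ((1 - theta) * mu).
have r0 : 0 < r by rewrite divr_gt0 // mulr_gt0.
have := h (ln r).
have -> : ln r = ln theta + ln (1 - mu) - (ln (1 - theta) + ln mu).
  by rewrite /r lnd ?mulr_gt0 // !lnM ?posrE.
set u := ln theta + _ - _ => hu.
have u0 : 0 <= u.
  have -> : u = ln r by rewrite /u /r lnd ?mulr_gt0 // !lnM ?posrE.
  rewrite ln_ge0 // /r ler_pdivlMr ?mulr_gt0 // mul1r.
  rewrite -subr_ge0 (_ : _ - _ = theta - mu) ?subr_ge0 ?ltW //; ring.
have := hu u0.
have -> : 1 + (expR u - 1) * mu = expR (ln (1 - mu) - ln (1 - theta)).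
  have -> : expR u = r by rewrite (_ : u = ln r) ?lnK // /u /r lnd ?mulr_gt0 // !lnM ?posrE.
  rewrite -lnd // lnK ?posrE ?divr_gt0 // /r.
  by field; rewrite !gt_eqF.
rewrite -expRD.
by have -> : - (u * theta) + (ln (1 - mu) - ln (1 - theta)) =
  - (theta * (ln theta - ln mu) + (1 - theta) * (ln (1 - theta) - ln (1 - mu)))
  by rewrite /u; ring.
Qed.

(** Exchanging success and failure of a Bernoulli variable: the substitution of [- t], [1 - theta],
    [1 - mu] for [t], [theta], [mu] preserves both the moment bound and the divergence. *)
Lemma chernoff_optimise_lower (q K mu theta : R) n : (0 < n)%N -> mu <= 1 ->
  0 <= theta <= mu ->
  (forall t, t <= 0 ->
     q <= K * (expR (- (t * theta)) * (1 + (expR t - 1) * mu)) ^+ n) ->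
  (q%:E <= K%:E * expeR (- (n%:R%:E * bdiv theta mu)))%E.
Proof.
move=> n0 mu1 /andP[t0 tm] h; rewrite -bdivC.
apply: chernoff_optimise => //; first by rewrite subr_ge0.
  by rewrite lerB //= lerBlDr lerDl.
move=> t tp; have := h (- t); rewrite oppr_le0 => /(_ tp).
have -> // : expR (- (- t * theta)) * (1 + (expR (- t) - 1) * mu) =
  expR (- (t * (1 - theta))) * (1 + (expR t - 1) * (1 - mu)).
have -> : - (- t * theta) = t + - (t * (1 - theta)) by ring.
rewrite expRD [expR t * _]mulrC -mulrA; congr (_ * _).
have e : expR t * expR (- t) = 1 by rewrite -expRD subrr expR0.
rewrite mulrDr mulr1 mulrA mulrBr e mulr1; ring.
Qed.

End Optimise.

(** * Block circulant matrices *)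

Section Tensor.
Context (R : realType).
Local Notation C := R[i].
Local Notation re := (@complex.Re R).
Local Notation im := (@complex.Im R).

Lemma bcircE m n p (A : tensor R m n p) i j :
  bcirc A i j = A (circ_idx (mxtens_unindex i).1 (mxtens_unindex j).1)
                   (mxtens_unindex i).2 (mxtens_unindex j).2.
Proof. by rewrite mxE. Qed.

Lemma bcircD m n p (A B : tensor R m n p) : bcirc (A + B) = bcirc A + bcirc B.
Proof. by apply/matrixP => i j; rewrite [RHS]mxE !bcircE ffunE mxE. Qed.

Lemma bcirc0 m n p : bcirc (0 : tensor R m n p) = 0.
Proof. by apply/matrixP => i j; rewrite [RHS]mxE !bcircE ffunE mxE. Qed.

Lemma bcircZ m n p (a : C) (A : tensor R m n p) : bcirc (a *: A) = a *: bcirc A.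
Proof. by apply/matrixP => i j; rewrite [RHS]mxE !bcircE ffunE mxE. Qed.

Lemma bcirc_sum m n p I (r : seq I) (A : I -> tensor R m n p) :
  bcirc (\sum_(k <- r) A k) = \sum_(k <- r) bcirc (A k).
Proof. by rewrite (big_morph _ (@bcircD m n p) (@bcirc0 m n p)). Qed.

(** [-(r - s) = s - r] modulo [p]. The proof splits on whether [r + p - s] reaches [p], that is, on
    [s <= r]. *)
Lemma rev_circ_idx p (r s : 'I_p) : rev_idx (circ_idx r s) = circ_idx s r.
Proof.
apply/val_inj => /=; have lr := ltn_ord r; have ls := ltn_ord s.
have [rs|sr] := leqP s r.
  rewrite (_ : r + p - s = (r - s) + p)%N; last by rewrite addnBAC.
  rewrite modnDr (modn_small (leq_ltn_trans (leq_subr _ _) lr)).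
  by congr (_ %% _)%N; rewrite subnBA // addnC.
rewrite (modn_small (_ : r + p - s < p)%N); last first.
  by rewrite ltn_subLR ?ltn_add2r // (leq_trans (ltnW ls)) ?leq_addl.
rewrite subnBA ?(leq_trans (ltnW ls)) ?leq_addl //.
by rewrite addnC subnDr -addnBAC ?(ltnW sr) // modnDr.
Qed.

Lemma bcirc_herm m p (A : tensor R m m p) : thermitian A -> ctrmx (bcirc A) = bcirc A.
Proof.
move=> hA; apply/matrixP => i j; rewrite !mxE -{2}hA /tctr ffunE rev_circ_idx.
by rewrite !mxE.
Qed.

Lemma psdmx_eigval N (M : 'M[C]_N) : ctrmx M = M -> psdmx M -> forall i, 0 <= eigval M i.
Proof.
move=> hM psd; apply: (unidiag_ge_qf (eigbasis_uni hM)) => v; rewrite spectral_decomp // mul0r.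
by have := psd v; rewrite lecE => /andP[_].
Qed.

Lemma eigval0 N (i : 'I_N) : eigval (0 : 'M[C]_N) i = 0.
Proof.
have h0 : ctrmx (0 : 'M[C]_N) = 0 by exact: ctrmx0.
have : 0 <= eigval (0 : 'M[C]_N) i <= 0.
  by apply: eigval_bounds => // v; rewrite mul0r /qf mulmx0 mul0mx mxE lexx.
by rewrite -eq_le => /eqP.
Qed.

Context (d : measure_display) (T : measurableType d) (P : probability T R).

Lemma eq_prob_off_null (Z A B : set T) : measurable Z -> P Z = 0%E ->
  measurable A -> measurable B -> (forall w, ~ Z w -> A w <-> B w) -> P A = P B.
Proof.
move=> mZ Z0 mA mB AB.
rewrite -(measureU0 mA mZ Z0) -(measureU0 mB mZ Z0); congr (P _).
by apply/seteqP; split => w [h|h]; try (by right);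
  have [Zw|Zw] := pselect (Z w); [right| left; apply/AB|right|left; apply/AB].
Qed.

Lemma ae_null_cover n (Q : 'I_n -> T -> Prop) : (forall i, {ae P, forall w, Q i w}) ->
  exists Z, [/\ measurable Z, P Z = 0%E & forall w, ~ Z w -> forall i, Q i w].
Proof.
move=> h; have /choice[Z hZ] : forall i, exists Z,
    [/\ measurable Z, P Z = 0%E & ~` [set w | Q i w] `<=` Z].
  by move=> i; have [Z [mZ Z0 sZ]] := h i; exists Z.
have [mU U0] : measurable (\big[setU/set0]_(i < n) Z i) /\
    P (\big[setU/set0]_(i < n) Z i) = 0%E.
  elim/big_rec : _ => [|i A _ [mA A0]]; first by split; [|exact: measure0].
  have [mZ Z0 _] := hZ i; split; first exact: measurableU.
  by rewrite -Z0; apply: measureU0.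
exists (\big[setU/set0]_(i < n) Z i); split => //.
move=> w nZ i; apply: contrapT => nQ; apply: nZ.
have [_ _ sZ] := hZ i; rewrite (bigD1 i) //=; left; exact: sZ.
Qed.

Lemma bcirc_preimage m p (B : set 'M[C]_(p * m)) : <<s @mx_gen R _ _ >> B ->
  tensor_measurable ((@bcirc R m m p) @^-1` B).
Proof.
apply: (@smallest_sub _ _ _ [set B | tensor_measurable ((@bcirc R m m p) @^-1` B)]); last first.
  move=> A [a [b [E mE AE]]] /=; apply: sub_sigma_algebra.
  exists (circ_idx (mxtens_unindex a).1 (mxtens_unindex b).1),
    (mxtens_unindex a).2, (mxtens_unindex b).2, E => //.
  by case: AE => ->; [left|right]; apply/funext => A' /=; rewrite /preimage /= bcircE.
split => /=.
- by rewrite preimage_set0; exact: sigma_algebra0.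
- move=> A mA; rewrite setTD preimage_setC -setTD.
  exact: sigma_algebraCD.
- by move=> A mA; rewrite preimage_bigcup;
  exact: (@sigma_algebra_bigcup _ setT (@tensor_gen R m m p)).
Qed.

Lemma bcirc_texpect m p (X : T -> tensor R m m p) :
  bcirc (texpect P X) = Emx P (fun w => bcirc (X w)).
Proof.
apply/matrixP => i j; rewrite bcircE ffunE !mxE.
by congr (Complex (fine 'E_P[_]) (fine 'E_P[_])); apply/funext => w; rewrite bcircE.
Qed.

Lemma mxmeas_bcirc m p (X : T -> tensor R m m p) :
  random_tensor X -> mxmeas (fun w => bcirc (X w)).
Proof.
move=> rX i j; have [r1 r2] := rX (circ_idx (mxtens_unindex i).1 (mxtens_unindex j).1)
  (mxtens_unindex i).2 (mxtens_unindex j).2.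
by split; under eq_fun do rewrite bcircE.
Qed.


Section Transfer.
Variables (m p n : nat) (X : 'I_n -> T -> tensor R m m p).
Hypotheses (m0 : (0 < m)%N) (p0 : (0 < p)%N)
  (rX : forall i, random_tensor (X i)) (iX : independent_tensors P X)
  (hX : forall i w, thermitian (X i w))
  (aeX : forall i, {ae P, forall w, tle 0 (X i w) /\ lambda_max (X i w) <= 1}).

(* Discarding a null set makes the almost sure spectral bounds hold everywhere. *)
Lemma bounded_version : exists (Z : set T) (Y : 'I_n -> T -> 'M[C]_(p * m)),
  [/\ measurable Z /\ P Z = 0%E,
      forall i w, ~ Z w -> Y i w = bcirc (X i w),
      (forall i w, ctrmx (Y i w) = Y i w) /\ (forall i w j, 0 <= eigval (Y i w) j <= 1),
      (forall i, mxmeas (Y i)) /\ mxindep P Y &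
      forall i, Emx P (Y i) = bcirc (texpect P (X i))].
Proof.
have [Z [mZ Z0 hZ]] := ae_null_cover aeX.
(* On the null set the matrix becomes zero, which is Hermitian with spectrum inside [[0, 1]]. *)
pose Y i w : 'M[C]_(p * m) := (\1_(~` Z) w)%:C%C *: bcirc (X i w).
have YX i w : ~ Z w -> Y i w = bcirc (X i w).
  by move=> nZ; rewrite /Y indicE mem_set // scale1r.
have Y0 i w : Z w -> Y i w = 0.
  by move=> Zw; rewrite /Y indicE memNset ?scale0r // => /(_ Zw).
have hY i w : ctrmx (Y i w) = Y i w by rewrite /Y ctrmxZ bcirc_herm.
have mXb i : mxmeas (fun w => bcirc (X i w)) by exact: mxmeas_bcirc.
have mY i : mxmeas (Y i).
  move=> a b; have [r1 r2] := mXb i a b.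
  have mI : measurable_fun setT (\1_(~` Z) : T -> R).
    by apply: measurable_indic; exact: measurableC.
  by split; rewrite /Y; under eq_fun do rewrite mxE ?reZ ?imZ; exact: measurable_funM.
exists Z, Y; split => //.
- split => // i w j; have [Zw|Zw] := pselect (Z w).
    by rewrite Y0 // eigval0 lexx ler01.
  rewrite YX //; have [pos le1] := hZ _ Zw i.
  have hb := bcirc_herm (hX i w).
  apply/andP; split.
    by apply: psdmx_eigval => //; move: pos; rewrite /tle subr0.
  have N0 : (0 < p * m)%N by rewrite muln_gt0 p0.
  by have [/(_ j) h _] := lmaxP N0 hb; exact: le_trans h le1.
- split => // B sB.
  have sB' i : tensor_measurable ((@bcirc R m m p) @^-1` B i) by exact: bcirc_preimage.
  have mYB i : measurable (Y i @^-1` B i) by exact: mxmeas_preimage.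
  have mXB i : measurable ((fun w => bcirc (X i w)) @^-1` B i) by exact: mxmeas_preimage.
  have := iX sB'.
  (* Each event of [Y] differs from that of [X] only inside [Z], so independence carries over. *)
  have e i : P (Y i @^-1` B i) = P (X i @^-1` ((@bcirc R m m p) @^-1` B i)).
    by apply: (eq_prob_off_null mZ) => //; [exact: mXB|move=> w nZ; rewrite /preimage /= YX].
  under eq_bigr do rewrite -e; move=> <-.
  apply: (eq_prob_off_null mZ) => //.
  + exact: fin_bigcap_measurable.
  + by apply: fin_bigcap_measurable => // i _; exact: mXB.
  + by move=> w nZ; split => h i _; have := h i Logic.I; rewrite /preimage /= YX.
- move=> i; rewrite bcirc_texpect; apply/matrixP => a b; rewrite !mxE.
  have [r1 r2] := mXb i a b; have [y1 y2] := mY i a b.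
  have ae (f : C -> R) : ae_eq P setT (fun w => (f (Y i w a b))%:E)
      (fun w => (f (bcirc (X i w) a b))%:E).
    exists Z; split => // w /= h; apply: contrapT => nZ; apply: h => _.
    by rewrite YX.
  rewrite !ExE /Rintegral; congr (Complex (fine _) (fine _)).
    by apply: ae_eq_integral => //; exact/measurable_EFinP.
  by apply: ae_eq_integral => //; exact/measurable_EFinP.
Qed.
End Transfer.
End Tensor.

Theorem theorem3 (d : measure_display) (T : measurableType d) (R : realType)
    (P : probability T R) (m p n : nat)
    (X : 'I_n -> T -> tensor R m m p) :
  (0 < m)%N -> (0 < p)%N -> (0 < n)%N ->
  (forall i, random_tensor (X i)) ->
  independent_tensors P X ->
  (forall i w, thermitian (X i w)) ->
  (forall i, {ae P, forall w, tle 0 (X i w) /\ lambda_max (X i w) <= 1}) ->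
  let Ebar : tensor R m m p := (n%:R^-1 : R[i]) *: \sum_(i < n) texpect P (X i) in
  let Xbar : T -> tensor R m m p := fun w => (n%:R^-1 : R[i]) *: \sum_(i < n) X i w in
  let mu_max := lambda_max Ebar in
  let mu_min := lambda_min Ebar in
  (forall theta : R, mu_max <= theta <= 1 ->
     (P [set w | (theta <= lambda_max (Xbar w))%R] <=
       ((m * p)%:R)%:E * expeR (- ((n%:R)%:E * bdiv theta mu_max)))%E) /\
  (forall theta : R, 0 <= theta <= mu_min ->
     (P [set w | (lambda_min (Xbar w) <= theta)%R] <=
       ((m * p)%:R)%:E * expeR (- ((n%:R)%:E * bdiv theta mu_min)))%E).
Proof.
move=> m0 p0 n0 rX iX hX aeX Ebar Xbar mu_max mu_min.
have [Z [Y [[mZ Z0] YX [hY Y01] [mY iY] EY]]] := bounded_version m0 p0 rX iX hX aeX.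
have N0 : (0 < p * m)%N by rewrite muln_gt0 p0.
have EbE : bcirc Ebar = n%:R^-1 *: \sum_i Emx P (Y i).
  by rewrite bcircZ bcirc_sum; congr (_ *: _); apply: eq_bigr => i _; rewrite EY.
have maxE : mu_max = lmax (n%:R^-1 *: \sum_i Emx P (Y i)).
  by rewrite -EbE.
have minE : mu_min = lmin (n%:R^-1 *: \sum_i Emx P (Y i)).
  by rewrite -EbE.
have XbE w : bcirc (Xbar w) = n%:R^-1 *: \sum_i bcirc (X i w).
  by rewrite bcircZ bcirc_sum.
have [lb ub] := Emx_mean_bounds P n0 N0 hY Y01 mY.
have lm := lmin_le_lmax P N0 hY Y01 mY.
have dimE : (m * p)%:R = (p * m)%:R :> R by rewrite mulnC.
have nC : (n%:R^-1 : R[i]) = (n%:R^-1 : R)%:C%C by rewrite fmorphV rmorph_nat.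
have hXb w : ctrmx (bcirc (Xbar w)) = bcirc (Xbar w).
  by rewrite XbE; apply: mean_herm => i; exact: bcirc_herm.
have mXb : mxmeas (fun w => bcirc (Xbar w)).
  under eq_fun do rewrite XbE nC; apply: mxmeasZ; apply: mxmeas_sum => i.
  exact: mxmeas_bcirc.
have hYb w : ctrmx (n%:R^-1 *: \sum_i Y i w) = n%:R^-1 *: \sum_i Y i w.
  exact: mean_herm.
have mYb : mxmeas (fun w => n%:R^-1 *: \sum_i Y i w).
  by under eq_fun do rewrite nC; apply: mxmeasZ; exact: mxmeas_sum.
have XY w : ~ Z w -> bcirc (Xbar w) = n%:R^-1 *: \sum_i Y i w.
  by move=> nZ; rewrite XbE; congr (_ *: _); apply: eq_bigr => i _; rewrite YX.
have maxXY w : ~ Z w -> lambda_max (Xbar w) = lmax (n%:R^-1 *: \sum_i Y i w).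
  by move=> nZ; exact: (congr1 (@lmax R _) (XY w nZ)).
have minXY w : ~ Z w -> lambda_min (Xbar w) = lmin (n%:R^-1 *: \sum_i Y i w).
  by move=> nZ; exact: (congr1 (@lmin R _) (XY w nZ)).
split=> theta ht.
  have mE : measurable [set w | (theta <= lambda_max (Xbar w))%R] :=
    measurable_lmax_ge theta N0 hXb mXb.
  have -> : P [set w | (theta <= lambda_max (Xbar w))%R] =
     P [set w | (theta <= lmax (n%:R^-1 *: \sum_i Y i w))%R].
    apply: (eq_prob_off_null mZ Z0 mE); first exact: measurable_lmax_ge.
    move=> w /maxXY e; split => h.
      by have h' : (theta <= lambda_max (Xbar w))%R := h; rewrite e in h'.
    by have h' : (theta <= lambda_max (Xbar w))%R; [rewrite e|exact: h'].
  (* The optimisation is stated for a real number, so the finite probability is passed through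
     [fine]. *)
  rewrite -[P _]fineK; last by apply: fin_num_measure; exact: measurable_lmax_ge.
  rewrite maxE in ht *.
  apply: (chernoff_optimise n0 (le_trans lb lm) ht) => t t0.
  rewrite dimE -lee_fin fineK; last by apply: fin_num_measure; exact: measurable_lmax_ge.
  exact: (lmax_tail n0 N0 hY Y01 mY iY theta t0).
have mE : measurable [set w | (lambda_min (Xbar w) <= theta)%R] :=
  measurable_lmin_le theta N0 hXb mXb.
have -> : P [set w | (lambda_min (Xbar w) <= theta)%R] =
   P [set w | (lmin (n%:R^-1 *: \sum_i Y i w) <= theta)%R].
  apply: (eq_prob_off_null mZ Z0 mE); first exact: measurable_lmin_le.
  move=> w /minXY e; split => h.
    by have h' : (lambda_min (Xbar w) <= theta)%R := h; rewrite e in h'.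
  by have h' : (lambda_min (Xbar w) <= theta)%R; [rewrite e|exact: h'].
rewrite -[P _]fineK; last by apply: fin_num_measure; exact: measurable_lmin_le.
rewrite minE in ht *.
apply: (chernoff_optimise_lower n0 (le_trans lm ub) ht) => t t0.
rewrite dimE -lee_fin fineK; last by apply: fin_num_measure; exact: measurable_lmin_le.
exact: (lmin_tail n0 N0 hY Y01 mY iY theta t0).
Qed.
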